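(* (Plancherel–Pólya inequality) Let $n\ge1$, $a>0$, $1<p<\infty$, and let $F\in\mathcal E_a$ be such that $\widetilde F_0\in L^p(\mathbb H_n)$. Then for all $h\in\mathbb R$, $$\int_{\mathbb H_n}|\widetilde F_h[z,t]|^p\,dz\,dt\le e^{aph_-}\,\|\widetilde F_0\|^p_{L^p(\mathbb H_n)},\qquad h_-=-\min(0,h).$$ In particular, $F\in H^p(\mathcal U_c)$ for all $c\in\mathbb R$.
   Context: For $\zeta=(\zeta',\zeta_{n+1})\in\mathbb C^n\times\mathbb C$ put $\Psi(\zeta)=(\zeta',\operatorname{Re}\zeta_{n+1},\operatorname{Im}\zeta_{n+1}-\frac14|\zeta'|^2)=:(z,t,h)$. For $F$ on $\mathbb C^{n+1}$ let $\widetilde F_h[z,t]=F(z,t+\frac i4|z|^2+ih)$; $\widetilde F_0$ is the restriction of $F$ to $b\mathcal U=\{\operatorname{Im}\zeta_{n+1}=\frac14|\zeta'|^2\}$, identified with the Heisenberg group $\mathbb H_n=\mathbb C^n\times\mathbb R$ with product $[w,s][z,t]=[w+z,s+t-\frac12\operatorname{Im}(w\cdot\bar z)]$ and Haar measure $dz\,dt$ (Lebesgue measure). $|[z,t]|=(\frac1{16}|z|^4+t^2)^{1/4}$ and $\|\zeta\|_{\mathcal U}=|[z,t]|^2+|h|$ where $\Psi(\zeta)=(z,t,h)$. $\mathcal E_a$ is the set of entire functions $F$ on $\mathbb C^{n+1}$ such that for every $\varepsilon>0$ there is $C_\varepsilon>0$ with $|F(\zeta)|\le C_\varepsilon e^{(a+\varepsilon)\|\zeta\|_{\mathcal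 U}}$ for all $\zeta$. $\mathcal U_c=\{\zeta:\operatorname{Im}\zeta_{n+1}>\frac14|\zeta'|^2+c\}$, and the Hardy space $H^p(\mathcal U_c)$ consists of the holomorphic $F$ on $\mathcal U_c$ with $\sup_{h>c}\|\widetilde F_h\|_{L^p(\mathbb H_n)}<\infty$ (functions on $\mathbb C^{n+1}$ are restricted to $\mathcal U_c$). *)

(* Defs.v *)
From HB Require Import structures.
From mathcomp Require Import all_boot all_order all_algebra.
From mathcomp Require Import all_classical all_reals all_analysis.
From mathcomp Require Import complex.

Set Implicit Arguments.
Unset Strict Implicit.
Unset Printing Implicit Defensive.

Import Order.TTheory GRing.Theory Num.Theory.
Import numFieldNormedType.Exports.

Local Open Scope classical_set_scope.
Local Open Scope ring_scope.
Local Open Scope complex_scope.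

Section sigma_finite_product.
Context d1 d2 (T1 : measurableType d1) (T2 : measurableType d2) (R : realType).
Variables (mu : {sigma_finite_measure set T1 -> \bar R})
  (nu : {sigma_finite_measure set T2 -> \bar R}).

(* An alias of mu \x nu: the library proves that mu \x nu is sigma-finite, but
   the corresponding canonical instance cannot be inferred. *)
Definition prod_measure : set (T1 * T2) -> \bar R := (mu \x nu)%E.

HB.instance Definition _ := Measure.copy prod_measure (mu \x nu)%E.

Let prod_measure_sigma_finite : sigma_finite setT prod_measure.
Proof.
have /sigma_finiteP[F [TF ndF Foo]] := sigma_finiteT mu.
have /sigma_finiteP[G [TG ndG Goo]] := sigma_finiteT nu.
exists (fun k => F k `*` G k).
  rewrite -setXTT TF TG predeqE => -[x y]; split.
    move=> [/= [i _ Fix] [j _ Gjy]]; exists (maxn i j) => //; split.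
    - by move: x Fix; exact/subsetPset/ndF/leq_maxl.
    - by move: y Gjy; exact/subsetPset/ndG/leq_maxr.
  by move=> [k _ []/= ? ?]; split; exists k.
move=> k; have [? ?] := Foo k; have [? ?] := Goo k.
split; first exact: measurableX.
rewrite [X in (X < _)%E]product_measure1E//.
by rewrite lte_mul_pinfty// ge0_fin_numE.
Qed.

HB.instance Definition _ := Measure_isSigmaFinite.Build _ _ _ prod_measure
  prod_measure_sigma_finite.

End sigma_finite_product.

Section cons_measure.
Context d (T : measurableType d) (R : realType) (n : nat).
Variables (mu : {sigma_finite_measure set T -> \bar R})
  (nu : {sigma_finite_measure set (n.-tuple T) -> \bar R}).

Definition tcons (x : T * n.-tuple T) : n.+1.-tuple T := [tuple of x.1 :: x.2].

Let tuncons (v : n.+1.-tuple T) : T * n.-tuple T :=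
  (thead v, [tuple of behead v]).

Let tconsK : cancel tcons tuncons.
Proof. by case=> x v; congr pair; apply/val_inj. Qed.

Lemma measurable_tcons : measurable_fun setT tcons.
Proof. exact: measurable_cons. Qed.

Let measurable_tuncons : measurable_fun setT tuncons.
Proof.
apply: measurable_fun_pair; first exact: measurable_tnth.
exact: measurable_behead.
Qed.

Definition cons_measure : set (n.+1.-tuple T) -> \bar R :=
  pushforward (prod_measure mu nu) tcons.

Let cons_measure0 : cons_measure set0 = 0%E.
Proof. by rewrite /cons_measure /pushforward preimage_set0 measure0. Qed.

Let cons_measure_ge0 A : (0 <= cons_measure A)%E.
Proof. by rewrite /cons_measure /pushforward measure_ge0. Qed.

Let cons_measure_sigma_additive : semi_sigma_additive cons_measure.
Proof.
move=> F mF tF mUF; rewrite /cons_measure /pushforward preimage_bigcup.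
apply: measure_semi_sigma_additive.
- by move=> k; rewrite -[X in measurable X]setTI; exact: measurable_tcons.
- apply/trivIsetP => /= i j _ _ ij; rewrite -preimage_setI.
  by move/trivIsetP : tF => /(_ _ _ _ _ ij) ->//; rewrite preimage_set0.
- by rewrite -preimage_bigcup -[X in measurable X]setTI; exact: measurable_tcons.
Qed.

HB.instance Definition _ := isMeasure.Build _ _ _ cons_measure
  cons_measure0 cons_measure_ge0 cons_measure_sigma_additive.

Let cons_measure_sigma_finite : sigma_finite setT cons_measure.
Proof.
have [F FT mF] := sigma_finiteT (prod_measure mu nu).
exists (fun k => tuncons @^-1` F k) => [|k].
  by rewrite -preimage_bigcup -FT preimage_setT.
have [mFk Fk] := mF k; split.
  by rewrite -[X in measurable X]setTI; exact: measurable_tuncons.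
rewrite /cons_measure /pushforward (_ : _ @^-1` _ = F k)//.
by apply/seteqP; split => x /=; rewrite tconsK.
Qed.

HB.instance Definition _ := Measure_isSigmaFinite.Build _ _ _ cons_measure
  cons_measure_sigma_finite.

End cons_measure.

(* The n-fold product measure mu \x ... \x mu on T^n. *)
Fixpoint tuple_measure d (T : measurableType d) (R : realType)
    (mu : {sigma_finite_measure set T -> \bar R}) (n : nat) :
    {sigma_finite_measure set (n.-tuple T) -> \bar R} :=
  match n with
  | 0 => \d_([tuple] : 0.-tuple T)
  | m.+1 => cons_measure mu (tuple_measure mu m)
  end.

(* C^n x C; the regular module R[i]^o is what carries the normed module
   structure of C over itself. *)
Definition Cn1 (R : realType) (n : nat) : normedModType R[i] :=
  ('rV[R[i]]_n * R[i]^o)%type.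

(* The underlying set of the Heisenberg group, with points [z, t]. *)
Notation heis R n := ('rV[R[i]]_n * R)%type.

(* Real coordinates on the Heisenberg group. *)
Notation heis_coord R n :=
  (n.-tuple (measurableTypeR R * measurableTypeR R) * measurableTypeR R)%type.

Section heisenberg.
Variables (R : realType) (n : nat).
Local Notation Cn1 := (Cn1 R n).
Local Notation heis := (heis R n).
Local Notation heis_coord := (heis_coord R n).

(* z_j = x_j + i y_j *)
Definition heis_of_coord (u : heis_coord) : heis :=
  (\row_j ((tnth u.1 j).1 +i* (tnth u.1 j).2), u.2).

(* Lebesgue measure dz dt, transported to the real coordinates. *)
Definition haar : {sigma_finite_measure set heis_coord -> \bar R} :=
  let leb : {sigma_finite_measure set (measurableTypeR R) -> \bar R} :=
    @lebesgue_measure R in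
  prod_measure (tuple_measure (prod_measure leb leb) n) leb.

Definition heis_integral (g : heis -> R) : \bar R :=
  (\int[haar]_u (g (heis_of_coord u))%:E)%E.

(* The L^p norm, with values in [0, +oo]. *)
Definition heis_Lnorm (p : R) (g : heis -> R[i]) : \bar R :=
  Lnorm haar p%:E (fun u => (Normc.normc (g (heis_of_coord u)))%:E).

Definition heis_Lp (p : R) (g : heis -> R[i]) : Prop :=
  [/\ measurable_fun setT (fun u => complex.Re (g (heis_of_coord u))),
      measurable_fun setT (fun u => complex.Im (g (heis_of_coord u))) &
      (heis_Lnorm p g < +oo)%E].

(* |z|^2 *)
Definition sqnorm (z : 'rV[R[i]]_n) : R :=
  \sum_(j < n) Normc.normc (z ord0 j) ^+ 2.

Definition Psi (zeta : Cn1) : heis * R :=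
  ((zeta.1, complex.Re zeta.2), complex.Im zeta.2 - 4^-1 * sqnorm zeta.1).

Definition slice (F : Cn1 -> R[i]^o) (h : R) (q : heis) : R[i] :=
  F (q.1, q.2 +i* (4^-1 * sqnorm q.1 + h)).

Definition heis_gauge (q : heis) : R :=
  (16^-1 * sqnorm q.1 ^+ 2 + q.2 ^+ 2) `^ 4^-1.

Definition gaugeU (zeta : Cn1) : R :=
  heis_gauge (Psi zeta).1 ^+ 2 + `|(Psi zeta).2|.

(* Holomorphy as Frechet differentiability over C. *)
Definition holomorphic_on (U : set Cn1) (F : Cn1 -> R[i]^o) : Prop :=
  forall zeta, U zeta -> differentiable F zeta.

Definition expo_type (a : R) (F : Cn1 -> R[i]^o) : Prop :=
  holomorphic_on setT F /\
  forall eps : R, 0 < eps -> exists2 C : R, 0 < C &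
    forall zeta, Normc.normc (F zeta) <= C * expR ((a + eps) * gaugeU zeta).

Definition siegel (c : R) : set Cn1 :=
  [set zeta | 4^-1 * sqnorm zeta.1 + c < complex.Im zeta.2].

(* Only the values of F on siegel c matter, since slice F h with h > c takes
   its arguments there. *)
Definition hardy (p c : R) (F : Cn1 -> R[i]^o) : Prop :=
  holomorphic_on (siegel c) F /\
  (ereal_sup [set heis_Lnorm p (slice F h) | h in [set h | (c < h)%R]]
     < +oo)%E.

End heisenberg.

(* Main.v *)
Require Import Defs.
From HB Require Import structures.
From mathcomp Require Import all_boot all_order all_algebra.
From mathcomp Require Import all_classical all_reals all_analysis.
From mathcomp Require Import complex measurable_realfun.
From mathcomp Require Import ring lra.

(* For h > 0 only translations are needed. The circle |w| = r in the complex line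
   w |-> (z + w e_0, zeta + (i/2) w conj z_0) lies at height h - r^2/4 and is swept
   out by Heisenberg translations, so that the sub-mean value property of |F|^p
   and the invariance of the Haar measure give ||F_h|| <= ||F_{h - r^2/4}||; take
   r = 2 sqrt h.

   For h < 0, fix z: the entire function G(w) = F(z, w + i|z|^2/4) satisfies
   |G(t + ih)| <= C exp((a + eps)(|t| + |h|)). In the strip |Im w| <= pi/2 put
   U(w) = int_{-S}^S |exp(-(a + eps) e^w) G(s - i e^w)|^p ds. On the two edges U is
   bounded by the integral of |G|^p over the real line, and on the real axis by
   a constant, so that Phragmen-Lindelof applies first in the two half-strips, to
   show that U is bounded, and then in the whole strip, to remove the constant.
   Now w = ln |h|, eps -> 0 and S -> +oo give the inequality for each z.

   Holomorphy is complex differentiability at each point, without any continuity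
   of the derivative, hence the mean value property is derived from Goursat's
   bisection argument. *)

Set Implicit Arguments.
Unset Strict Implicit.
Unset Printing Implicit Defensive.

Import Order.TTheory GRing.Theory Num.Theory.
Import numFieldNormedType.Exports.

Local Open Scope classical_set_scope.
Local Open Scope ring_scope.
Local Open Scope complex_scope.

(** * Complex numbers as a normed space *)

(** Under w -> - i e^w exponential type becomes growth like exp(b e^|u|), u = Re w. For the strip
    |Im w| <= pi/2, of width pi, this is exactly the critical rate, so Phragmen-Lindelof does not
    apply there at once. The factor exp(-(a + eps) e^w) cancels the growth on the real axis and has
    modulus 1 on the edges; a half-strip has width pi/2 and tolerates every rate below 2. Hence the
    two passes. The range of s is cut at S because nothing says beforehand that |G|^p is integrable
    on horizontal lines other than the real one; the cut makes U finite and continuous. The constant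
    in the growth of G depends on z through exp((a + eps)|z|^2/4), but the inequality on a line
    involves only the type a, so it can be integrated in z. Both regimes rest on one fact, the
    sub-mean value property of |f|^p for entire f of one variable. Phragmen-Lindelof multiplies by
    |m|^p with m entire, which leads to averages of such functions again. *)

Lemma normCE (R : realType) (z : R[i]) : `|z| = (Normc.normc z)%:C.
Proof. by case: z. Qed.

(** A positive element of [R[i]] is a positive real number, so the radii of balls may be taken in
    [R]. *)
Lemma cvgc_dist_lt (R : realType) (T : Type) (F : set_system T) {FF : Filter F}
    (f : T -> R[i]^o) (l : R[i]^o) :
  f @ F --> l <->
  forall e : R, 0 < e -> \forall t \near F, Normc.normc (l - f t) < e.
Proof.
split=> [/cvgrPdist_lt fl e e0|fl].
  have /fl : 0 < e%:C by rewrite ltcR.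
  by apply: filterS => t; rewrite normCE ltcR.
apply/cvgrPdist_lt => e e0.
have [er ei] : e = (complex.Re e)%:C /\ 0 < complex.Re e.
  by move: e e0 => [x y]; rewrite ltcE /= => /andP[/eqP -> ].
by have := fl _ ei; apply: filterS => t; rewrite normCE er ltcR.
Qed.

Lemma normc_ge0 (R : realType) (z : R[i]) : 0 <= Normc.normc z.
Proof. by rewrite -lecR -normCE normr_ge0. Qed.

Lemma normcB (R : realType) (z w : R[i]) :
  Normc.normc (z - w) = Normc.normc (w - z).
Proof. by rewrite -normcN opprB. Qed.

Lemma ler_normc_Re (R : realType) (z : R[i]) :
  `|complex.Re z| <= Normc.normc z.
Proof. by rewrite -lecR -normCE normc_ge_Re. Qed.

Lemma ler_normc_Im (R : realType) (z : R[i]) :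
  `|complex.Im z| <= Normc.normc z.
Proof.
case: z => x y /=; rewrite -sqrtr_sqr ler_wsqrtr//.
by rewrite lerDr sqr_ge0.
Qed.

Lemma ler_dist_normc (R : realType) (z w : R[i]) :
  `|Normc.normc z - Normc.normc w| <= Normc.normc (z - w).
Proof.
rewrite ler_norml; apply/andP; split.
  rewrite lerNl opprB lerBlDr -{1}(subrK z w) (le_trans (le_normcD _ _))//.
  by rewrite normcB.
by rewrite lerBlDr -{1}(subrK w z) le_normcD.
Qed.

Lemma cvgr_dist_ltP (R : realType) (T : Type) (F : set_system T)
    {FF : Filter F} (f : T -> R) (l : R) :
  f @ F --> l <-> forall e : R, 0 < e -> \forall t \near F, `|l - f t| < e.
Proof. exact: cvgrPdist_lt. Qed.

Lemma ReB (R : realType) (z w : R[i]) :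
  complex.Re (z - w) = complex.Re z - complex.Re w.
Proof. by case: z; case: w. Qed.

Lemma ImB (R : realType) (z w : R[i]) :
  complex.Im (z - w) = complex.Im z - complex.Im w.
Proof. by case: z; case: w. Qed.

Section continuity_of_coordinates.
Context (R : realType) (T : Type) (F : set_system T) {FF : Filter F}.

Lemma cvg_normc (f : T -> R[i]^o) (l : R[i]^o) : f @ F --> l ->
  Normc.normc (f t) @[t --> F] --> Normc.normc l.
Proof.
move=> /cvgc_dist_lt fl; apply/cvgr_dist_ltP => e /fl.
by apply: filterS => t; exact/le_lt_trans/ler_dist_normc.
Qed.

Lemma cvg_Re (f : T -> R[i]^o) (l : R[i]^o) : f @ F --> l ->
  complex.Re (f t) @[t --> F] --> complex.Re l.
Proof.
move=> /cvgc_dist_lt fl; apply/cvgr_dist_ltP => e /fl.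
apply: filterS => t; apply: le_lt_trans.
by rewrite -ReB ler_normc_Re.
Qed.

Lemma cvg_Im (f : T -> R[i]^o) (l : R[i]^o) : f @ F --> l ->
  complex.Im (f t) @[t --> F] --> complex.Im l.
Proof.
move=> /cvgc_dist_lt fl; apply/cvgr_dist_ltP => e /fl.
apply: filterS => t; apply: le_lt_trans.
by rewrite -ImB ler_normc_Im.
Qed.

Lemma ler_normc_ReIm (z : R[i]) :
  Normc.normc z <= `|complex.Re z| + `|complex.Im z|.
Proof.
case: z => x y /=; rewrite -[leRHS]ger0_norm ?addr_ge0// -sqrtr_sqr.
rewrite ler_wsqrtr// sqrrD !real_normK ?num_real// -addrA lerD2l lerDr.
by rewrite mulrn_wge0 ?mulr_ge0.
Qed.

Lemma cvg_Complex (x y : T -> R) (a b : R) : x @ F --> a -> y @ F --> b ->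
  (x t +i* y t : R[i]^o) @[t --> F] --> (a +i* b : R[i]^o).
Proof.
move=> /cvgr_dist_ltP xa /cvgr_dist_ltP yb; apply/cvgc_dist_lt => e e0.
have e20 : 0 < e / 2 by rewrite divr_gt0.
near=> t; apply: le_lt_trans (ler_normc_ReIm _) _.
rewrite (splitr e) ltrD//=; near: t; [exact: xa|exact: yb].
Unshelve. all: by end_near. Qed.

End continuity_of_coordinates.


Lemma nbhs_normcP (R : realType) (w : R[i]^o) (P : set R[i]^o) :
  nbhs w P <-> exists2 d : R, 0 < d & forall v, Normc.normc (w - v) < d -> P v.
Proof.
split=> [/nbhs_ballP[d /= d0]|[d d0 H]].
  rewrite -[ball _ _]/(ball_ _ _ _) => H.
  have dE : d = (complex.Re d)%:C.
    by move: d d0 {H} => [x y]; rewrite ltcE /= => /andP[/eqP -> ].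
  exists (complex.Re d) => [|v vd]; first by rewrite -ltcR -dE.
  by apply: H; rewrite /= normCE dE ltcR.
apply/nbhs_ballP; exists d%:C => /=; first by rewrite ltcR.
by rewrite -[ball _ _]/(ball_ _ _ _) => v /=; rewrite normCE ltcR; exact: H.
Qed.

(** The field is general because the lemma serves both the real functions exp, cos, sin and the
    complex functions of [cderivable_expand]. *)
Lemma derivable_expand (K : numFieldType) (f : K^o -> K^o) (w : K^o) :
  derivable f w 1 -> forall e : K, 0 < e ->
  exists2 d : K, 0 < d &
    forall v, `|v| < d -> `|f (w + v) - f w - v * 'D_1 f w| <= e * `|v|.
Proof.
move=> /derivable1_diffP df e e0.
have [_ /eqaddoP] := (diff_locallyP w f).1 df.
move=> /(_ e e0) /nbhs_ballP[d /= d0].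
rewrite -[ball _ _]/(ball_ _ _ _) => H.
exists d => // v vd.
have /H : ball_ Num.norm (0 : K^o) d v by rewrite /= sub0r normrN.
rewrite (_ : f _ - _ - _ = (f \o shift w - (cst (f w) + 'd f w)) v)//.
have -> : (f \o shift w - (cst (f w) + 'd f w)) v = f (v + w) - (f w + 'd f w v).
  by [].
by rewrite diff1E// derive1E opprD addrA [v + w]addrC.
Qed.

Lemma cderivable_expand (R : realType) (f : R[i]^o -> R[i]^o) (w : R[i]^o) :
  differentiable f w -> exists l : R[i], forall e : R, 0 < e ->
    exists2 d : R, 0 < d & forall v, Normc.normc v < d ->
      Normc.normc (f (w + v) - f w - v * l) <= e * Normc.normc v.
Proof.
move=> /derivable1_diffP/derivable_expand df; exists ('D_1 f w) => e e0.
have [|d d0 H] := df e%:C; first by rewrite ltcR.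
have dE : d = (complex.Re d)%:C.
  by move: d d0 {H} => [x y]; rewrite ltcE /= => /andP[/eqP -> ].
exists (complex.Re d) => [|v vd]; first by rewrite -ltcR -dE.
by have := H v; rewrite !normCE dE ltcR -rmorphM lecR => /(_ vd).
Qed.

Lemma cderivable_of_expand (R : realType) (f : R[i]^o -> R[i]^o) (w l : R[i]^o) :
  (forall e : R, 0 < e ->
    exists2 d : R, 0 < d & forall v, Normc.normc v < d ->
      Normc.normc (f (w + v) - f w - v * l) <= e * Normc.normc v) ->
  differentiable f w.
Proof.
move=> H; apply/derivable1_diffP/cvg_ex; exists l.
apply/cvgc_dist_lt => e e0.
have e20 : 0 < e / 2 by rewrite divr_gt0.
have [d d0 {}H] := H _ e20.
apply/nbhs_normcP; exists d => // v; rewrite sub0r normcN => vd v0.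
have nv0 : 0 < Normc.normc v.
  rewrite lt_neqAle normc_ge0 andbT eq_sym; apply: contra v0.
  by move=> /eqP/Normc.eq0_normc ->.
rewrite normcB (_ : _ - l = v^-1 * (f (w + v) - f w - v * l)); last first.
  rewrite mulrBr mulKf// /GRing.scale/= [v * 1]mulr1 [v + w]addrC //.
rewrite Normc.normcM Normc.normcV ltr_pdivrMl//.
rewrite (le_lt_trans (H _ vd))// mulrC ltr_pM2l//.
by rewrite ltr_pdivrMr// ltr_pMr// ltr1n.
Qed.

(** * The complex exponential *)

Definition cexp (R : realType) (w : R[i]^o) : R[i]^o :=
  (expR (complex.Re w) * cos (complex.Im w)) +i*
  (expR (complex.Re w) * sin (complex.Im w)).

Lemma cexpD (R : realType) (v w : R[i]) : cexp (v + w) = cexp v * cexp w.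
Proof.
case: v w => [a b] [c d]; rewrite /cexp /= expRD cosD sinD.
by apply/eqP; rewrite eq_complex /=; apply/andP; split; apply/eqP; ring.
Qed.

Lemma normc_cexp (R : realType) (w : R[i]) :
  Normc.normc (cexp w) = expR (complex.Re w).
Proof.
rewrite /cexp/= !exprMn -mulrDr cos2Dsin2 mulr1 sqrtr_sqr ger0_norm// expR_ge0.
Qed.

(** By [cexpD] the increment at w is [cexp w] times the increment at 0, so the expansions of exp,
    cos and sin at 0 suffice. *)
Lemma differentiable_cexp (R : realType) (w : R[i]^o) :
  differentiable (@cexp R) w.
Proof.
apply: (@cderivable_of_expand _ _ _ (cexp w)) => e e0.
set E := Normc.normc (cexp w).
have E0 : 0 < E by rewrite /E normc_cexp expR_gt0.
(* The four error terms [k1] to [k4] add up to at most 7 e' |v|; the factor E comes from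
   [cexp w]. *)
pose e' := Num.min 1 (e / (8 * E)).
have e'0 : 0 < e' by rewrite lt_min ltr01/= divr_gt0// mulr_gt0.
have e'1 : e' <= 1 by rewrite ge_min lexx.
have e'e : e' * 8 * E <= e.
  by rewrite -mulrA -ler_pdivlMr ?mulr_gt0// ge_min lexx orbT.
have [d1 d10 H1] := @derivable_expand R expR 0 (@derivable_expR R 0) _ e'0.
have [d2 d20 H2] := @derivable_expand R cos 0 (@derivable_cos R 0) _ e'0.
have [d3 d30 H3] := @derivable_expand R sin 0 (@derivable_sin R 0) _ e'0.
rewrite !derive_val in H1 H2 H3.
(* The bound e'/2 on |x| controls the cross term x sin y, because |sin y| <= 2 |y|. *)
pose d := Num.min (Num.min d1 d2) (Num.min d3 (e' / 2)).
exists d; first by rewrite !lt_min d10 d20 d30 divr_gt0.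
move=> v vd.
have vx := le_lt_trans (ler_normc_Re v) vd.
have vy := le_lt_trans (ler_normc_Im v) vd.
have {H1}H1 : `|expR (complex.Re v) - 1 - complex.Re v| <= e' * `|complex.Re v|.
  have := H1 (complex.Re v); rewrite add0r expR0 mulr1; apply.
  by rewrite (lt_le_trans vx)// !ge_min lexx.
have {H2}H2 : `|cos (complex.Im v) - 1| <= e' * `|complex.Im v|.
  have := H2 (complex.Im v); rewrite add0r cos0 sin0 oppr0 mulr0 subr0; apply.
  by rewrite (lt_le_trans vy)// !ge_min lexx orbT.
have {H3}H3 : `|sin (complex.Im v) - complex.Im v| <= e' * `|complex.Im v|.
  have := H3 (complex.Im v); rewrite add0r sin0 cos0 mulr1 subr0; apply.
  by rewrite (lt_le_trans vy)// !ge_min lexx !orbT.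
have xe' : `|complex.Re v| <= e' / 2.
  by rewrite (le_trans (ltW vx))// !ge_min lexx !orbT.
rewrite cexpD -[X in _ - X - _]mul1r mulrC -!mulrBl Normc.normcM -/E.
suff : Normc.normc (cexp v - 1 - v) <= e' * 8 * Normc.normc v.
  move=> /(ler_wpM2r (ltW E0)) /le_trans; apply.
  by rewrite mulrAC ler_wpM2r// normc_ge0.
apply: le_trans (ler_normc_ReIm _) _.
have := ler_normc_Re v; have := ler_normc_Im v.
move: (Normc.normc v) => N; rewrite /cexp.
case: v {vd vx vy} H1 H2 H3 xe' => x y /= H1 H2 H3 xe' yN xN.
have -> : expR x * cos y - 1 - x =
    (expR x - 1 - x) * cos y + (1 + x) * (cos y - 1) by ring.
have -> : expR x * sin y - 0 - y =
    ((expR x - 1 - x) + x) * sin y + (sin y - y) by ring.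
have c1 : `|cos y| <= 1 by rewrite ler_norml cos_geN1 cos_le1.
have s1 : `|sin y| <= 1 by rewrite ler_norml sin_geN1 sin_le1.
have sy : `|sin y| <= 2 * `|y|.
  rewrite -(subrK y (sin y)) (le_trans (ler_normD _ _))//.
  rewrite [2]/(1 + 1) mulrDl mul1r lerD2r (le_trans H3)// ler_piMl//.
have k1 : `|(expR x - 1 - x) * cos y| <= e' * N.
  rewrite normrM (le_trans (ler_piMr _ c1))// (le_trans H1)//.
  by rewrite ler_wpM2l// ltW.
have k2 : `|(1 + x) * (cos y - 1)| <= 2 * (e' * N).
  rewrite normrM ler_pM//.
    rewrite (le_trans (ler_normD _ _))// normr1 [2]/(1 + 1) lerD2l.
    by rewrite (le_trans xe')// ler_pdivrMr// (le_trans e'1)// mul1r ler1n.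
  by rewrite (le_trans H2)// ler_wpM2l// ltW.
have k3 : `|((expR x - 1 - x) + x) * sin y| <= 3 * (e' * N).
  rewrite mulrDl (le_trans (ler_normD _ _))//.
  have -> : 3 * (e' * N) = e' * N + 2 * (e' * N) by ring.
  apply: lerD.
    rewrite normrM (le_trans (ler_piMr _ s1))// (le_trans H1)//.
    by rewrite ler_wpM2l// ltW.
  rewrite normrM (le_trans (ler_pM _ _ xe' sy))//.
  have -> : e' / 2 * (2 * `|y|) = e' * `|y| by field.
  have N0 : 0 <= e' * `|y| by rewrite mulr_ge0// ltW.
  have : e' * `|y| <= e' * N by rewrite ler_wpM2l// ltW.
  by move: N0; lra.
have k4 : `|sin y - y| <= e' * N by rewrite (le_trans H3)// ler_wpM2l// ltW.
have k5 := ler_normD ((expR x - 1 - x) * cos y) ((1 + x) * (cos y - 1)).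
have k6 := ler_normD (((expR x - 1 - x) + x) * sin y) (sin y - y).
have N0 : 0 <= e' * N by apply: mulr_ge0; [exact: ltW|exact: le_trans xN].
lra.
Qed.

(** * Goursat's theorem *)

(** The integral is not oriented: it vanishes when b < a. *)
Definition itv_int (R : realType) (a b : R) (f : R -> R) : R :=
  \int[lebesgue_measure]_(x in `[a, b]) f x.

Section itv_int.
Variable R : realType.
Implicit Types (f g : R -> R) (a b c : R).

Lemma integrable_itv f a b : continuous f ->
  lebesgue_measure.-integrable `[a, b] (EFin \o f).
Proof.
move=> cf; apply: continuous_compact_integrable; first exact: segment_compact.
exact: continuous_subspaceT.
Qed.

Lemma itv_int_cst a b c : a <= b -> itv_int a b (cst c) = c * (b - a).
Proof.
move=> ab; rewrite /itv_int Rintegral_cst//=; congr (_ * _).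
have -> : lebesgue_measure `[a, b]%classic = (b - a)%:E; last by [].
rewrite lebesgue_measure_itv /= lte_fin.
by move: ab; rewrite le_eqVlt => /predU1P[->|->]//; rewrite ltxx subrr.
Qed.

Lemma itv_intD f g a b : continuous f -> continuous g ->
  itv_int a b (fun x => f x + g x) = itv_int a b f + itv_int a b g.
Proof.
by move=> cf cg; rewrite /itv_int RintegralD//; exact: integrable_itv.
Qed.

Lemma itv_intB f g a b : continuous f -> continuous g ->
  itv_int a b (fun x => f x - g x) = itv_int a b f - itv_int a b g.
Proof.
by move=> cf cg; rewrite /itv_int RintegralB//; exact: integrable_itv.
Qed.

Lemma itv_int_split f a b c : continuous f -> a <= b -> b <= c ->
  itv_int a c f = itv_int a b f + itv_int b c f.
Proof.
move=> cf ab bc; apply/eqP; rewrite addrC -subr_eq; apply/eqP.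
rewrite /itv_int Rintegral_itvB ?bnd_simp//; last exact: integrable_itv.
rewrite Rintegral_itv_obnd_cbnd//.
apply: integrableS (integrable_itv b c cf) => //.
by apply: subset_itvr; rewrite bnd_simp.
Qed.

Lemma le_itv_int f g a b : continuous f -> continuous g ->
  (forall x, a <= x <= b -> f x <= g x) -> itv_int a b f <= itv_int a b g.
Proof.
move=> cf cg fg; apply: le_Rintegral => //.
- exact: (integrable_itv a b cf).
- exact: (integrable_itv a b cg).
Qed.

Lemma itv_int_dist f a b c e : continuous f -> a <= b ->
  (forall x, a <= x <= b -> `|f x - c| <= e) ->
  `|itv_int a b f - c * (b - a)| <= e * (b - a).
Proof.
move=> cf ab fe; rewrite -(itv_int_cst c ab) -itv_intB//; last first.
  by move=> x; exact: cvg_cst.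
have cfc : continuous (fun x => f x - c).
  by move=> x; apply: cvgB; [exact: cf|exact: cvg_cst].
rewrite ler_norml -mulNr -!itv_int_cst//; apply/andP; split;
  apply: le_itv_int => //; try by move=> x; exact: cvg_cst.
all: by move=> x /fe; rewrite ler_norml => /andP[].
Qed.

End itv_int.

Lemma nested_intervals (R : realType) (x : R ^nat) (d : R ^nat) :
  (forall k, 0 <= d k) ->
  (forall k, x k <= x k.+1) -> (forall k, x k.+1 + d k.+1 <= x k + d k) ->
  exists X, forall k, x k <= X <= x k + d k.
Proof.
move=> d0 x_nd xd_ni.
have xle j k : (j <= k)%N -> x j <= x k.
  by move=> jk; move: j k jk; exact/nondecreasing_seqP.
have xdge j k : (j <= k)%N -> x k + d k <= x j + d j.
  by move=> jk; move: j k jk; exact/(nonincreasing_seqP (fun k => x k + d k)).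
have xxd j k : x j <= x k + d k.
  rewrite (le_trans (xle _ _ (leq_maxl j k)))//.
  by rewrite (le_trans _ (xdge _ _ (leq_maxr j k)))// lerDl.
exists (sup (range x)) => k; apply/andP; split.
  apply: ub_le_sup; last by exists k.
  by exists (x 0%N + d 0%N) => _ [j _ <-].
by apply: ge_sup; [exists (x 0%N), 0%N|move=> _ [j _ <-]].
Qed.

Section goursat.
Variables (R : realType) (f : R[i]^o -> R[i]^o).
Hypothesis df : forall w, differentiable f w.

Let P x y := complex.Re (f (x +i* y)).
Let Q x y := complex.Im (f (x +i* y)).

Lemma continuous_entire : continuous f.
Proof. by move=> w; exact/differentiable_continuous/df. Qed.

Let cfx y : continuous (fun x => f (x +i* y)).
Proof.
move=> x; apply: (@cvg_comp _ _ _ (fun x => x +i* y : R[i]^o) f).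
  by apply: cvg_Complex; [exact: cvg_id|exact: cvg_cst].
exact: continuous_entire.
Qed.

Let cfy x : continuous (fun y => f (x +i* y)).
Proof.
move=> y; apply: (@cvg_comp _ _ _ (fun y => x +i* y : R[i]^o) f).
  by apply: cvg_Complex; [exact: cvg_cst|exact: cvg_id].
exact: continuous_entire.
Qed.

Let cPx y : continuous (P ^~ y).
Proof. by move=> x; apply: cvg_Re; exact: cfx. Qed.

Let cQy x : continuous (Q x).
Proof. by move=> y; apply: cvg_Im; exact: cfy. Qed.

(* The real part of the integral of f(w) dw along the boundary of
   [x, x + a] x [y, y + b]. *)
Let E x y a b :=
  itv_int x (x + a) (fun t => P t y - P t (y + b)) +
  itv_int y (y + b) (fun t => Q x t - Q (x + a) t).

Let Eh x y a a' b : 0 <= a -> 0 <= a' -> 0 <= b ->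
  E x y (a + a') b = E x y a b + E (x + a) y a' b.
Proof.
move=> a0 a'0 b0; rewrite /E !itv_intB// (addrA x a a').
rewrite !(@itv_int_split _ _ x (x + a) (x + a + a')) ?lerDl//.
by ring.
Qed.

Let Ev x y a b b' : 0 <= a -> 0 <= b -> 0 <= b' ->
  E x y a (b + b') = E x y a b + E x (y + b) a b'.
Proof.
move=> a0 a'0 b0; rewrite /E !itv_intB// (addrA y b b').
rewrite !(@itv_int_split _ _ y (y + b) (y + b + b')) ?lerDl//.
by ring.
Qed.

(** Common sides cancel in [Eh] and [Ev], so E is the sum over the four quarters and they cannot all
    be small. *)
Let Equarter x y a b : 0 <= a -> 0 <= b -> exists q : R * R,
  [/\ x <= q.1, q.1 + a / 2 <= x + a, y <= q.2, q.2 + b / 2 <= y + b &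
      `|E x y a b| <= 4 * `|E q.1 q.2 (a / 2) (b / 2)| ].
Proof.
move=> a0 b0; have a20 : 0 <= a / 2 by rewrite divr_ge0.
have b20 : 0 <= b / 2 by rewrite divr_ge0.
have aE : a / 2 + a / 2 = a by rewrite -splitr.
have bE : b / 2 + b / 2 = b by rewrite -splitr.
have EE : E x y a b = E x y (a / 2) (b / 2) + E (x + a / 2) y (a / 2) (b / 2) +
  (E x (y + b / 2) (a / 2) (b / 2) + E (x + a / 2) (y + b / 2) (a / 2) (b / 2)).
  have e1 := Eh x y a20 a20 b20; have e2 := Eh x (y + b / 2) a20 a20 b20.
  have e3 := Ev x y a0 b20 b20.
  by rewrite aE in e1 e2; rewrite bE in e3; rewrite e3 e1 e2.
apply: contrapT => /forallNP nq.
have small x' y' : x <= x' -> x' + a / 2 <= x + a -> y <= y' ->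
    y' + b / 2 <= y + b -> 4 * `|E x' y' (a / 2) (b / 2)| < `|E x y a b|.
  move=> h1 h2 h3 h4; rewrite ltNge; apply/negP => h5.
  by apply: (nq (x', y')).
have s1 : 4 * `|E x y (a / 2) (b / 2)| < `|E x y a b| by apply: small; lra.
have s2 : 4 * `|E (x + a / 2) y (a / 2) (b / 2)| < `|E x y a b|.
  by apply: small; lra.
have s3 : 4 * `|E x (y + b / 2) (a / 2) (b / 2)| < `|E x y a b|.
  by apply: small; lra.
have s4 : 4 * `|E (x + a / 2) (y + b / 2) (a / 2) (b / 2)| < `|E x y a b|.
  by apply: small; lra.
move: s1 s2 s3 s4; rewrite EE.
set e1 := E x y _ _; set e2 := E _ y _ _; set e3 := E x _ _ _.
set e4 := E _ _ _ _ => s1 s2 s3 s4.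
have := ler_normD (e1 + e2) (e3 + e4).
have := ler_normD e1 e2; have := ler_normD e3 e4.
lra.
Qed.

(** The affine part of f contributes b a Im l on the horizontal sides and the opposite on the
    vertical ones. The remainder is at most e (a + b) at each boundary point. *)
Let E_local x y a b X Y l e : 0 <= a -> 0 <= b -> 0 <= e ->
  x <= X <= x + a -> y <= Y <= y + b ->
  (forall v, Normc.normc v <= a + b ->
    Normc.normc (f ((X +i* Y) + v) - f (X +i* Y) - v * l) <= e * Normc.normc v) ->
  `|E x y a b| <= 4 * e * (a + b) ^+ 2.
Proof.
move=> a0 b0 e0 hX hY H.
pose p := f (X +i* Y).
have loc s t : x <= s <= x + a -> y <= t <= y + b ->
    let r := f (s +i* t) - p - ((s - X) +i* (t - Y)) * l in
    `|complex.Re r| <= e * (a + b) /\ `|complex.Im r| <= e * (a + b).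
  move=> hs ht /=.
  have vab : Normc.normc ((s - X) +i* (t - Y)) <= a + b.
    apply: (le_trans (ler_normc_ReIm _)) => /=; apply: lerD;
    by rewrite ler_norml; lra.
  have := H _ vab.
  have -> : (X +i* Y) + ((s - X) +i* (t - Y)) = (s +i* t).
    by apply/eqP; rewrite eq_complex /= ![_ + (_ - _)]addrC !subrK !eqxx.
  move=> Hr; have {}Hr := le_trans Hr (ler_wpM2l e0 vab).
  by split; apply: le_trans Hr; [exact: ler_normc_Re|exact: ler_normc_Im].
have ReE (z : R[i]) (u v : R) :
  complex.Re (z - p - (u +i* v) * l) =
  complex.Re z - complex.Re p - (u * complex.Re l - v * complex.Im l).
  by case: z => z1 z2; case: (p) => ? ?; case: (l).
have ImE (z : R[i]) (u v : R) :
  complex.Im (z - p - (u +i* v) * l) =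
  complex.Im z - complex.Im p - (u * complex.Im l + v * complex.Re l).
  by case: z => z1 z2; case: (p) => ? ?; case: (l).
have h1 : `|itv_int x (x + a) (fun t => P t y - P t (y + b)) -
    b * complex.Im l * (x + a - x)| <= 2 * e * (a + b) * (x + a - x).
  apply: itv_int_dist; [|lra|].
    by move=> t; apply: cvgB; exact: cPx.
  move=> t ht.
  have [] := loc t y ht; first lra.
  have [] := loc t (y + b) ht; first lra.
  rewrite !ReE -/(P t y) -/(P t (y + b)) !ler_norml => h1 _ h2 _.
  by move: h1 h2; move: (P t y) (P t (y + b)) (complex.Re p) => *; lra.
have h2 : `|itv_int y (y + b) (fun t => Q x t - Q (x + a) t) -
    (- a * complex.Im l) * (y + b - y)| <= 2 * e * (a + b) * (y + b - y).
  apply: itv_int_dist; [|lra|].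
    by move=> t; apply: cvgB; exact: cQy.
  move=> t ht.
  have [] := loc x t _ ht; first lra.
  have [] := loc (x + a) t _ ht; first lra.
  rewrite !ImE -/(Q x t) -/(Q (x + a) t) !ler_norml => _ h3 _ h4.
  by move: h3 h4; move: (Q x t) (Q (x + a) t) (complex.Im p) => *; lra.
move: h1 h2; rewrite /E; set A := itv_int x _ _; set B := itv_int y _ _.
rewrite (addrC x a) (addrC y b) !addrK => h1 h2.
have -> : A + B = (A - b * complex.Im l * a) + (B - - a * complex.Im l * b) by ring.
rewrite (le_trans (ler_normD _ _))// (le_trans (lerD h1 h2))//.
have -> : 2 * e * (a + b) * a + 2 * e * (a + b) * b = 2 * (e * (a + b) ^+ 2).
  by ring.
by rewrite -mulrA ler_wpM2r ?ler_nat// mulr_ge0// sqr_ge0.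
Qed.

(** Repeated quartering shrinks to a point where the first-order expansion of f contradicts a
    nonzero E. The real part of the contour integral is enough, since on vertical sides it is, up to
    sign, the integral of Im f. *)
Lemma goursat x y a b : 0 <= a -> 0 <= b -> E x y a b = 0.
Proof.
move=> a0 b0; apply/eqP/contraT => E0.
have c0 : 0 < `|E x y a b| by rewrite normr_gt0.
(* The signs of the sides are premises so that the choice is total; [(0, 0)] is a dummy value when a
   side is negative. *)
have /choice[g gP] : forall q : R * R * (R * R), exists q' : R * R,
  0 <= q.2.1 -> 0 <= q.2.2 ->
  [/\ q.1.1 <= q'.1, q'.1 + q.2.1 / 2 <= q.1.1 + q.2.1,
   q.1.2 <= q'.2, q'.2 + q.2.2 / 2 <= q.1.2 + q.2.2 &
      `|E q.1.1 q.1.2 q.2.1 q.2.2| <= 4 * `|E q'.1 q'.2 (q.2.1 / 2) (q.2.2 / 2)| ].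
  move=> [[x1 y1] [a1 b1]]/=.
  have [a1_0|a1_0] := leP 0 a1; last by exists (0, 0).
  have [b1_0|b1_0] := leP 0 b1; last by exists (0, 0).
  by have [q ?] := Equarter x1 y1 a1_0 b1_0; exists q.
pose step (q : R * R * (R * R)) := (g q, (q.2.1 / 2, q.2.2 / 2)).
pose s k := iter k step ((x, y), (a, b)).
have sE k : (s k).2 = (a / 2 ^+ k, b / 2 ^+ k).
  elim: k => [|k IH]; first by rewrite !expr0 !divr1.
  by rewrite [s k.+1]/= /step /= IH/= !exprSr !invfM !mulrA.
have s1 k : 0 <= (s k).2.1 by rewrite sE divr_ge0// exprn_ge0.
have s2 k : 0 <= (s k).2.2 by rewrite sE divr_ge0// exprn_ge0.
have sP k := gP (s k) (s1 k) (s2 k).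
have [X HX] := @nested_intervals R (fun k => (s k).1.1) (fun k => (s k).2.1) s1
  (fun k => let: And5 h _ _ _ _ := sP k in h)
  (fun k => let: And5 _ h _ _ _ := sP k in h).
have [Y HY] := @nested_intervals R (fun k => (s k).1.2) (fun k => (s k).2.2) s2
  (fun k => let: And5 _ _ h _ _ := sP k in h)
  (fun k => let: And5 _ _ _ h _ := sP k in h).
have Ek k : `|E x y a b| <= 4 ^+ k *
    `|E (s k).1.1 (s k).1.2 (s k).2.1 (s k).2.2|.
  elim: k => [|k IH]; first by rewrite expr0 mul1r.
  rewrite (le_trans IH)// exprSr -mulrA ler_pM2l ?exprn_gt0//.
  by have [_ _ _ _] := sP k.
have [l Hl] := cderivable_expand (df (X +i* Y)).
(* This keeps 4 e (a + b)^2 below |E x y a b|. The factor 4^k lost in k bisections is offset by the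
   square of the halved sides in [E_local]; the summand 1 covers a = b = 0. *)
pose e := `|E x y a b| / (8 * ((a + b) ^+ 2 + 1)).
have ab1 : 0 < (a + b) ^+ 2 + 1 by rewrite ltr_wpDl// sqr_ge0.
have e0 : 0 < e by rewrite divr_gt0// mulr_gt0.
have [d d0 Hd] := Hl _ e0.
have [k kd] : exists k, (a + b) / 2 ^+ k < d.
  have : ((a + b) * (2^-1) ^+ k @[k --> \oo] --> 0).
    rewrite -(mulr0 (a + b)); apply: cvgMr => //.
    by apply: cvg_expr; rewrite ger0_norm// invf_lt1// ltr1n.
  move=> /cvgr_dist_ltP/(_ _ d0)[k _ /(_ k (leqnn k))] kd; exists k.
  move: kd; rewrite /= sub0r normrN ger0_norm ?exprVn//.
  by rewrite mulr_ge0 ?addr_ge0// invr_ge0 exprn_ge0.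
have := Ek k; have := sE k; have := HX k; have := HY k; have := s1 k; have := s2 k.
move: (s k) => [[xk yk] [ak bk]] /= bk0 ak0 hY hX [akE bkE] /le_trans.
have abk : ak + bk < d by rewrite akE bkE -mulrDl.
have := @E_local xk yk ak bk X Y l e ak0 bk0 (ltW e0) hX hY.
case/(_ _)/Wrap => [v vk|h]; first by apply: Hd; exact: le_lt_trans abk.
have p4 : 4 ^+ k * (ak + bk) ^+ 2 = (a + b) ^+ 2.
  rewrite akE bkE -mulrDl expr_div_n -exprM mulnC exprM.
  rewrite (_ : 2 ^+ 2 = 4); last by rewrite -natrX.
  by rewrite mulrC divfK// expf_neq0.
move=> /(_ _ (ler_wpM2l (exprn_ge0 _ (ler0n _ 4)) h)).
rewrite mulrCA p4 => h'; exfalso; move: h'; apply/negP; rewrite -ltNge.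
have -> : `|E x y a b| = 8 * (e * (a + b) ^+ 2) + 8 * e.
  by rewrite /e; field; rewrite gt_eqF.
have : 0 <= e * (a + b) ^+ 2 by rewrite mulr_ge0 ?sqr_ge0// ltW.
rewrite -[4 * e * _]mulrA; move: (e * _ ^+ 2) e0 => u.
by move: (e) => e1; lra.
Qed.

End goursat.

(** * Mean values *)

Definition circ (R : realType) (r t : R) : R[i]^o := (r * cos t) +i* (r * sin t).

Lemma normc_circ (R : realType) (r t : R) : 0 <= r ->
  Normc.normc (circ r t) = r.
Proof.
by move=> r0; rewrite /= !exprMn -mulrDr cos2Dsin2 mulr1 sqrtr_sqr ger0_norm.
Qed.

Lemma continuous_circ (R : realType) (r : R) : continuous (circ r).
Proof.
move=> t; apply: cvg_Complex; apply: cvgMr; [|].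
- exact: continuous_cos.
- exact: continuous_sin.
Qed.

Lemma differentiable_add_cexp (R : realType) (f : R[i]^o -> R[i]^o) (w0 : R[i]^o) :
  (forall w, differentiable f w) ->
  forall w, differentiable (fun w => f (w0 + cexp w)) w.
Proof.
move=> df w; apply: (@differentiable_comp _ _ _ _ (fun w => w0 + cexp w)).
  by apply: differentiableD => //; exact: differentiable_cexp.
exact: df.
Qed.

Section mean_value.
Variables (R : realType) (f : R[i]^o -> R[i]^o).
Hypothesis df : forall w, differentiable f w.
Variable w0 : R[i]^o.

Let I r := itv_int 0 (pi *+ 2) (fun t => complex.Im (f (w0 + circ r t))).

Lemma continuous_on_circ r : continuous (fun t => f (w0 + circ r t)).
Proof.
move=> t; apply: (@cvg_comp _ _ _ (fun t => w0 + circ r t) f).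
  by apply: cvgD; [exact: cvg_cst|exact: continuous_circ].
exact: continuous_entire.
Qed.

Let cI r : continuous (fun t => complex.Im (f (w0 + circ r t))).
Proof. by move=> t; apply: cvg_Im; exact: continuous_on_circ. Qed.

Let pi2_ge0 : 0 <= pi *+ 2 :> R.
Proof. by rewrite mulrn_wge0// pi_ge0. Qed.

(* In the coordinate w0 + e^w the circles centred at w0 become vertical
   segments, and the horizontal sides of a rectangle of height 2 pi cancel. *)
Let I_cst r1 r2 : 0 < r1 -> r1 <= r2 -> I r1 = I r2.
Proof.
move=> r10 r12; have r20 := lt_le_trans r10 r12.
have s12 : 0 <= ln r2 - ln r1 by rewrite subr_ge0 ler_ln.
have := goursat (differentiable_add_cexp w0 df) (ln r1) 0 s12 pi2_ge0.
rewrite [ln r1 + _]addrC subrK add0r.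
rewrite (_ : (fun t => _ - _) = cst 0); last first.
  apply/funext => t /=; rewrite /cexp/= cos0 sin0 cos2pi sin2pi subrr//.
rewrite itv_int_cst ?ler_ln// mul0r add0r.
have cE r : 0 < r -> (fun t => complex.Im (f (w0 + cexp (ln r +i* t)))) =
    (fun t => complex.Im (f (w0 + circ r t))).
  by move=> r0; apply/funext => t; rewrite /cexp/= lnK.
rewrite itv_intB ?cE//; [|exact: cI..].
by move=> /eqP; rewrite subr_eq0 => /eqP.
Qed.

(** By [I_cst] the circle can be shrunk until f differs from f(w0) by less than any prescribed
    amount on it. *)
Lemma mean_value_Im r : 0 < r -> I r = pi *+ 2 * complex.Im (f w0).
Proof.
move=> r0; apply/eqP; rewrite -subr_eq0 -normr_le0; apply/ler_addgt0Pl => e e0.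
rewrite addr0.
have e'0 : 0 < e / (pi *+ 2) by rewrite divr_gt0// mulrn_wgt0// pi_gt0.
have /cvgc_dist_lt/(_ _ e'0)/nbhs_normcP[d d0 H] := @continuous_entire _ _ df w0.
pose r' := Num.min r (d / 2).
have r'0 : 0 < r' by rewrite lt_min r0 divr_gt0.
have r'd : r' < d by rewrite gt_min ltr_pdivrMr// ltr_pMr// ltr1n orbT.
rewrite -(@I_cst r' r)//; last by rewrite ge_min lexx.
rewrite [_ * complex.Im _]mulrC.
have := @itv_int_dist _ _ 0 (pi *+ 2) (complex.Im (f w0)) _ (@cI r') pi2_ge0.
move=> /(_ (e / (pi *+ 2))); rewrite subr0 divfK; last first.
  by rewrite gt_eqF// mulrn_wgt0// pi_gt0.
apply=> t _; rewrite -ImB (le_trans (ler_normc_Im _))//.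
rewrite normcB ltW//; apply: H.
by rewrite opprD addNKr normcN normc_circ// ltW.
Qed.

End mean_value.

(** [mean_value_Im] is applied to c f, where c has modulus 1 and c f(w0) = i |f(w0)|. *)
Lemma submean_normc (R : realType) (f : R[i]^o -> R[i]^o) w0 r :
  (forall w, differentiable f w) -> 0 < r ->
  pi *+ 2 * Normc.normc (f w0) <=
  itv_int 0 (pi *+ 2) (fun t => Normc.normc (f (w0 + circ r t))).
Proof.
move=> df r0.
have [c c1 cf] : exists2 c : R[i], Normc.normc c = 1 &
    complex.Im (c * f w0) = Normc.normc (f w0).
  have [fw0|fw0] := eqVneq (f w0) 0.
    by exists 1; rewrite ?Normc.normc1// fw0 mulr0 Normc.normc0.
  have nf0 : Normc.normc (f w0) != 0.
    by apply: contra fw0 => /eqP/Normc.eq0_normc ->.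
  exists ('i%C * (f w0)^*%C / (Normc.normc (f w0))%:C).
    rewrite !Normc.normcM Normc.normcV.
    have -> : Normc.normc ((Normc.normc (f w0))%:C) = Normc.normc (f w0).
      by rewrite /= expr0n addr0 sqrtr_sqr ger0_norm// normc_ge0.
    have -> : Normc.normc ((f w0)^*)%C = Normc.normc (f w0).
      by case: (f w0) => a b /=; rewrite sqrrN.
    by rewrite /= expr0n expr1n add0r sqrtr1 mul1r mulfV.
  have nE : (f w0)^*%C * f w0 = (Normc.normc (f w0))%:C ^+ 2.
    by rewrite mulrC -sqr_normc normCE.
  rewrite mulrAC -['i%C * _ * _]mulrA nE expr2 mulrA mulfK; last first.
    by rewrite (_ : 0 = 0%:C)// (inj_eq (@complexI R)).
  by rewrite /= mul0r mul1r add0r.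
have dcf w : differentiable (fun w => c * f w : R[i]^o) w.
  by apply: differentiableM.
rewrite -cf -(mean_value_Im dcf w0 r0).
apply: le_itv_int => [t|t|t _].
- by apply: cvg_Im; exact: (continuous_on_circ dcf).
- by apply: cvg_normc; exact: continuous_on_circ.
- rewrite (le_trans (ler_norm _))// (le_trans (ler_normc_Im _))//.
  by rewrite Normc.normcM c1 mul1r.
Qed.

(** Convexity of x^p in the form needed for Jensen's inequality. It is Young's inequality for x and
    m^(p-1) with the exponents p and p/(p-1). *)
Lemma powR_tangent (R : realType) (p m x : R) : 1 < p -> 0 <= m -> 0 <= x ->
  m `^ p + p * m `^ (p - 1) * (x - m) <= x `^ p.
Proof.
move=> p1 m0 x0; have p0 : 0 < p by rewrite (lt_trans _ p1).
have pm0 : 0 < p - 1 by rewrite subr_gt0.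
have q1 : (p - 1) * (p / (p - 1)) = p by rewrite mulrC divfK// gt_eqF.
have pq : p^-1 + (p / (p - 1))^-1 = 1 by field; rewrite !gt_eqF.
have := conjugate_powR x0 (powR_ge0 m (p - 1)) p0 (divr_gt0 p0 pm0) pq.
rewrite -powRrM q1 -(mulr_powRB1 m0 p0) -(ler_pM2l p0).
move: (m `^ (p - 1)) (x `^ p) => B C.
have -> : p * (C / p + m * B / (p / (p - 1))) = C + m * B * (p - 1).
  by field; rewrite !gt_eqF.
lra.
Qed.

(** For l > 0 the power is differentiable at l; at l = 0 the condition x^p < e is read as x <
    e^(1/p). *)
Lemma cvg_powR_l (R : realType) (T : Type) (F : set_system T) {FF : Filter F}
    (f : T -> R) (l p : R) : 0 < p -> 0 <= l -> (forall t, 0 <= f t) ->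
  f @ F --> l -> f t `^ p @[t --> F] --> l `^ p.
Proof.
move=> p0; rewrite le_eqVlt => /predU1P[<-|l0] f0 fl; last first.
  apply: (@cvg_comp _ _ _ f (fun x => x `^ p) F (nbhs l)) => //.
  apply: (@differentiable_continuous _ R^o R^o l (fun x => x `^ p)).
  by apply/derivable1_diffP; apply: derivable_powR; rewrite in_itv/= l0.
rewrite powR0 ?gt_eqF//; apply/cvgr_dist_ltP => e e0.
have e'0 : 0 < e `^ p^-1 by rewrite powR_gt0.
move/cvgr_dist_ltP : fl => /(_ _ e'0); apply: filterS => t.
rewrite !sub0r !normrN !ger0_norm ?powR_ge0// => /(gt0_ltr_powR p0).
rewrite !nnegrE f0 powR_ge0 -powRrM mulVf ?gt_eqF// powRr1 ?(ltW e0)//.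
by apply.
Qed.

Lemma cvg_normc_powR (R : realType) (T : Type) (F : set_system T)
    {FF : Filter F} (f : T -> R[i]^o) (l : R[i]^o) (p : R) : 0 < p ->
  f @ F --> l -> Normc.normc (f t) `^ p @[t --> F] --> Normc.normc l `^ p.
Proof.
move=> p0 fl; apply: cvg_powR_l => //; first exact: normc_ge0.
  by move=> t; exact: normc_ge0.
exact: cvg_normc.
Qed.

(** Jensen's inequality: the tangent of x^p at m = |f(w0)| is integrated along the circle, and its
    slope is nonnegative, so [submean_normc] bounds the linear term from below. *)
Lemma submean_powR (R : realType) (f : R[i]^o -> R[i]^o) w0 r p :
  1 < p -> (forall w, differentiable f w) -> 0 < r ->
  pi *+ 2 * Normc.normc (f w0) `^ p <=
  itv_int 0 (pi *+ 2) (fun t => Normc.normc (f (w0 + circ r t)) `^ p).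
Proof.
move=> p1 df r0; have p0 : 0 < p by rewrite (lt_trans _ p1).
set m := Normc.normc (f w0).
have pi2_ge0 : 0 <= pi *+ 2 :> R by rewrite mulrn_wge0// pi_ge0.
have cn : continuous (fun t => Normc.normc (f (w0 + circ r t))).
  by move=> t; apply: cvg_normc; exact: continuous_on_circ.
pose c := p * m `^ (p - 1).
have ct : continuous (fun t => c * Normc.normc (f (w0 + circ r t))).
  by move=> t; apply: cvgMr; exact: cn.
pose c' := m `^ p - c * m.
apply: (@le_trans _ _ (itv_int 0 (pi *+ 2)
    (fun t => c * Normc.normc (f (w0 + circ r t)) + cst c' t))).
  rewrite itv_intD//; last by move=> t; exact: cvg_cst.
  rewrite itv_int_cst// subr0 [X in X + _]RintegralZl//; last first.
    exact: integrable_itv.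
  have c0 : 0 <= c by rewrite mulr_ge0// ?powR_ge0// ltW.
  have := ler_wpM2l c0 (submean_normc w0 df r0).
  rewrite -/m -/(itv_int _ _ _) /c'.
  by move: (itv_int _ _ _) (m `^ p) => I M; lra.
apply: le_itv_int => [t|t|t _].
- by apply: cvgD; [exact: ct|exact: cvg_cst].
- by apply: cvg_normc_powR => //; exact: continuous_on_circ.
- have := powR_tangent p1 (normc_ge0 (f w0)) (normc_ge0 (f (w0 + circ r t))).
  by rewrite -/m -/c /c' /cst; lra.
Qed.

Lemma itv_intE (R : realType) (a b : R) (f : R -> R) : continuous f ->
  (itv_int a b f)%:E = (\int[lebesgue_measure]_(x in `[a, b]) (f x)%:E)%E.
Proof.
move=> cf; rewrite /itv_int /Rintegral fineK//.
by apply: integrable_fin_num => //; exact: integrable_itv.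
Qed.

(** * Maximum principle and Phragmen-Lindelof *)

Lemma continuous_pair (T T1 T2 : topologicalType) (f : T -> T1) (g : T -> T2) :
  continuous f -> continuous g -> continuous (fun t => (f t, g t)).
Proof. by move=> cf cg t; apply: cvg_pair; [exact: cf|exact: cg]. Qed.

Lemma continuous_add (K : numFieldType) (V : normedModType K)
    (T : topologicalType) (f g : T -> V) :
  continuous f -> continuous g -> continuous (fun t => f t + g t).
Proof. by move=> cf cg t; apply: cvgD; [exact: cf|exact: cg]. Qed.

Lemma continuous_after (T T1 T2 : topologicalType) (f : T1 -> T2) (g : T -> T1) :
  continuous f -> continuous g -> continuous (fun t => f (g t)).
Proof.
by move=> cf cg t; apply: (@continuous_comp _ _ _ g f); [exact: cg|exact: cf].
Qed.

Lemma continuous_const (T1 T2 : topologicalType) (y : T2) :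
  continuous (fun _ : T1 => y).
Proof. by move=> x; exact: cvg_cst. Qed.

Lemma continuous_proj1 (T1 T2 : topologicalType) : continuous (@fst T1 T2).
Proof. by move=> x; exact: cvg_fst. Qed.

Lemma continuous_proj2 (T1 T2 : topologicalType) : continuous (@snd T1 T2).
Proof. by move=> x; exact: cvg_snd. Qed.

Lemma continuous_partial1 (T1 T2 T3 : topologicalType) (f : T1 * T2 -> T3) y :
  continuous f -> continuous (fun x => f (x, y)).
Proof.
move=> cf x; apply: (@continuous_comp _ _ _ (fun x => (x, y)) f); last exact: cf.
by apply: (@cvg_pair _ _ _ (nbhs x)); [exact: cvg_id|exact: cvg_cst].
Qed.

Lemma continuous_partial2 (T1 T2 T3 : topologicalType) (f : T1 * T2 -> T3) x :
  continuous f -> continuous (fun y => f (x, y)).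
Proof.
move=> cf y; apply: (@continuous_comp _ _ _ (fun y => (x, y)) f); last exact: cf.
by apply: (@cvg_pair _ _ _ (nbhs y)); [exact: cvg_cst|exact: cvg_id].
Qed.

Lemma continuous_swap_args (T1 T2 T3 : topologicalType) (f : T1 * T2 -> T3) :
  continuous f -> continuous (fun q => f (q.2, q.1)).
Proof.
move=> cf q; apply: (@continuous_comp _ _ _ (fun q => (q.2, q.1)) f); last exact: cf.
by apply: (@cvg_pair _ _ _ (nbhs q)); [exact: cvg_snd|exact: cvg_fst].
Qed.

Lemma continuous_mulr (R : realType) (T : topologicalType) (f g : T -> R) :
  continuous f -> continuous g -> continuous (fun w => f w * g w).
Proof. by move=> cf cg w; apply: cvgM; [exact: cf|exact: cg]. Qed.

Lemma continuous_normc (R : realType) (T : topologicalType) (f : T -> R[i]^o) :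
  continuous f -> continuous (fun t => Normc.normc (f t)).
Proof. by move=> cf t; apply: cvg_normc; exact: cf. Qed.

Lemma continuous_Complex (R : realType) (T : topologicalType) (x y : T -> R) :
  continuous x -> continuous y -> continuous (fun t => x t +i* y t : R[i]^o).
Proof. by move=> cx cy t; apply: cvg_Complex; [exact: cx|exact: cy]. Qed.

Lemma continuous_normc_powR (R : realType) (T : topologicalType)
    (f : T -> R[i]^o) (p : R) : 0 < p -> continuous f ->
  continuous (fun w => Normc.normc (f w) `^ p).
Proof. by move=> p0 cf w; apply: cvg_normc_powR => //; exact: cf. Qed.

(* Quantifying over all entire multipliers m makes this class stable under
   multiplication by |m|^p, which is what the Phragmen-Lindelof argument uses. *)
Definition log_subharmonic (R : realType) (p : R) (U : R[i]^o -> R) :=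
  [/\ continuous U, forall w, 0 <= U w &
   forall (m : R[i]^o -> R[i]^o) (w0 : R[i]^o) (r : R),
     (forall w, differentiable m w) -> 0 < r ->
     pi *+ 2 * (Normc.normc (m w0) `^ p * U w0) <=
     itv_int 0 (pi *+ 2) (fun t => Normc.normc (m (w0 + circ r t)) `^ p *
                                   U (w0 + circ r t))].

Lemma log_subharmonicM (R : realType) (p : R) (U : R[i]^o -> R)
    (m : R[i]^o -> R[i]^o) : 0 < p ->
  (forall w, differentiable m w) -> log_subharmonic p U ->
  log_subharmonic p (fun w => Normc.normc (m w) `^ p * U w).
Proof.
move=> p0 dm [cU U0 sU]; split.
- apply: continuous_mulr cU; apply: continuous_normc_powR => //.
  exact: continuous_entire.
- by move=> w; rewrite mulr_ge0// powR_ge0.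
- move=> m' w0 r dm' r0.
  have dmm' w : differentiable (fun w => m' w * m w : R[i]^o) w.
    by apply: (@differentiableM _ _ m' m); [exact: dm'|exact: dm].
  have E w : Normc.normc (m' w) `^ p * (Normc.normc (m w) `^ p * U w) =
    Normc.normc (m' w * m w) `^ p * U w.
    by rewrite Normc.normcM powRM ?normc_ge0// mulrA.
  rewrite E (le_trans (sU _ w0 r dmm' r0))//.
  by rewrite /itv_int; under [leRHS]eq_Rintegral do rewrite E.
Qed.

Lemma log_subharmonic_submean (R : realType) (p : R) (U : R[i]^o -> R) w0 r :
  log_subharmonic p U -> 0 < r ->
  pi *+ 2 * U w0 <= itv_int 0 (pi *+ 2) (fun t => U (w0 + circ r t)).
Proof.
move=> [_ _ sU] r0; have := sU (cst 1) w0 r (fun w => differentiable_cst _ _) r0.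
rewrite /cst Normc.normc1 powR1 mul1r => /le_trans; apply.
by rewrite /itv_int; under eq_Rintegral do rewrite mul1r.
Qed.

(** The integrand is the imaginary part of (y + i x) w on the circle |w| = r, whose mean is the
    value 0 at the centre. *)
Lemma itv_int_trig (R : realType) (x y r : R) : 0 < r ->
  itv_int 0 (pi *+ 2) (fun t => r * (x * cos t + y * sin t)) = 0.
Proof.
move=> r0; pose f (w : R[i]^o) : R[i]^o := (y +i* x) * w.
have df w : differentiable f w.
  by apply: (@differentiableM _ _ (cst (y +i* x)) id).
have := mean_value_Im df 0 r0; rewrite /f mulr0 [complex.Im 0]/= mulr0 => h.
rewrite -[RHS]h; apply: eq_Rintegral => t _.
by rewrite add0r /=; ring.
Qed.

(** Adding k |w|^2 makes the sub-mean inequality strict, so the sum V has no interior maximum on the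
    rectangle. For small k a value of U above M also keeps the maximum of V off the boundary. *)
Lemma max_principle (R : realType) (p : R) (U : R[i]^o -> R) (x1 x2 y1 y2 M : R) :
  log_subharmonic p U ->
  (forall x y, x1 <= x <= x2 -> y1 <= y <= y2 ->
    [|| x == x1, x == x2, y == y1 | y == y2] -> U (x +i* y) <= M) ->
  forall x y, x1 <= x <= x2 -> y1 <= y <= y2 -> U (x +i* y) <= M.
Proof.
move=> sU bM x0 y0 hx0 hy0; rewrite leNgt; apply/negP => Mlt.
have [cU U0 _] := sU.
pose B := (`|x1| + `|x2|) ^+ 2 + (`|y1| + `|y2|) ^+ 2.
have B0 : 0 <= B by rewrite addr_ge0// sqr_ge0.
have sqB (a b x : R) : a <= x <= b -> x ^+ 2 <= (`|a| + `|b|) ^+ 2.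
  move=> axb; rewrite -[x ^+ 2]real_normK ?num_real// ler_sqr ?nnegrE ?addr_ge0//.
  rewrite ler_norml; have := ler_norm b; have := ler_norm (- a).
  by rewrite normrN; have := normr_ge0 a; have := normr_ge0 b; lra.
(* B bounds |w|^2 on the rectangle, so V is at most M + k B on the boundary, while U(x0 + i y0) = M
   + 2 k (B + 1). *)
pose k := (U (x0 +i* y0) - M) / (2 * (B + 1)).
have k0 : 0 < k by rewrite divr_gt0 ?subr_gt0// mulr_gt0// ltr_wpDl.
have kE : U (x0 +i* y0) = M + 2 * (k * (B + 1)).
  by rewrite /k; field; rewrite gt_eqF// ltr_wpDl.
pose V (q : R * R) := U (q.1 +i* q.2) + k * (q.1 ^+ 2 + q.2 ^+ 2).
have cV : continuous V.
  move=> q; apply: cvgD.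
    apply: (@cvg_comp _ _ _ (fun q : R * R => q.1 +i* q.2 : R[i]^o) U).
      by apply: cvg_Complex; [exact: cvg_fst|exact: cvg_snd].
    exact: cU.
  apply: cvgMr; apply: cvgD; rewrite expr2; under eq_cvg do rewrite expr2.
    by apply: cvgM; exact: cvg_fst.
  by apply: cvgM; exact: cvg_snd.
have [|||[x y]] := @compact_EVT_max _ R V (`[x1, x2] `*` `[y1, y2]).
- by exists (x0, y0); split; rewrite /= in_itv.
- by apply: compact_setX; exact: segment_compact.
- exact: continuous_subspaceT.
rewrite inE => -[/=]; rewrite !in_itv/= => hx hy maxV.
have {}maxV x' y' : x1 <= x' <= x2 -> y1 <= y' <= y2 -> V (x', y') <= V (x, y).
  by move=> hx' hy'; apply: maxV; rewrite inE; split; rewrite /= in_itv.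
have Vgt : M + k * B < V (x, y).
  rewrite (lt_le_trans _ (maxV x0 y0 hx0 hy0))// /V/= kE.
  have : 0 <= k * (x0 ^+ 2 + y0 ^+ 2).
    by rewrite mulr_ge0 ?(ltW k0)// addr_ge0// sqr_ge0.
  have : 0 <= k * B by rewrite mulr_ge0// ltW.
  by move: k0; lra.
have nb : ~~ [|| x == x1, x == x2, y == y1 | y == y2].
  apply/negP => /(bM x y hx hy) UM; move: Vgt; apply/negP; rewrite -leNgt /V/=.
  by rewrite lerD// ler_pM2l// lerD// sqB.
move: nb; rewrite !negb_or => /and4P[nx1 nx2 ny1 ny2].
have hx' : x1 < x < x2.
  by move: hx; rewrite !le_eqVlt [x1 == x]eq_sym (negPf nx1) (negPf nx2).
have hy' : y1 < y < y2.
  by move: hy; rewrite !le_eqVlt [y1 == y]eq_sym (negPf ny1) (negPf ny2).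
pose r := Num.min (Num.min (x - x1) (x2 - x)) (Num.min (y - y1) (y2 - y)).
have r0 : 0 < r by rewrite !lt_min !subr_gt0; lra.
have [rx1 rx2 ry1 ry2] : [/\ r <= x - x1, r <= x2 - x, r <= y - y1 & r <= y2 - y].
  by split; rewrite /r !ge_min lexx ?orbT.
have := log_subharmonic_submean (x +i* y) sU r0.
have pi2_ge0 : 0 <= pi *+ 2 :> R by rewrite mulrn_wge0// pi_ge0.
have cc : continuous (fun t : R => r * (x * cos t + y * sin t)).
  move=> t; apply: cvgMr; apply: cvgD; apply: cvgMr.
    exact: continuous_cos.
  exact: continuous_sin.
have cc' : continuous (fun t : R => 2 * k * (r * (x * cos t + y * sin t))).
  by move=> t; apply: cvgMr; exact: cc.
have c1 : continuous (cst (U (x +i* y) - k * r ^+ 2) : R -> R).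
  by move=> t; exact: cvg_cst.
apply/negP; rewrite -ltNge.
(* Maximality of V bounds U on the circle by U(x + i y) - k r^2 minus a trigonometric term of mean
   zero, which contradicts the sub-mean inequality. *)
apply: (@le_lt_trans _ _ (itv_int 0 (pi *+ 2)
  (fun t => cst (U (x +i* y) - k * r ^+ 2) t - 2 * k * (r * (x * cos t + y * sin t))))).
  apply: le_itv_int.
  - apply: continuous_after => // t.
    by apply: cvgD; [exact: cvg_cst|exact: continuous_circ].
  - by move=> t; apply: cvgB; [exact: c1|exact: cc'].
  - move=> t _; have := maxV (x + r * cos t) (y + r * sin t).
    have rc : - r <= r * cos t <= r.
      by rewrite -mulrN1 ler_pM2l// cos_geN1/= ler_piMr ?cos_le1// ltW.
    have rs : - r <= r * sin t <= r.
      by rewrite -mulrN1 ler_pM2l// sin_geN1/= ler_piMr ?sin_le1// ltW.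
    case/(_ _ _)/Wrap => [||]; [lra|lra|].
    rewrite /V/= -[circ r t]/(_ +i* _) -[(x +i* y) + _]/(_ +i* _) /cst.
    move: (U _) (U _) => u1 u2.
    have -> : (x + r * cos t) ^+ 2 + (y + r * sin t) ^+ 2 =
        x ^+ 2 + y ^+ 2 + r ^+ 2 * (cos t ^+ 2 + sin t ^+ 2) +
        2 * (r * (x * cos t + y * sin t)) by ring.
    by rewrite cos2Dsin2; lra.
rewrite itv_intB// itv_int_cst// subr0 [X in _ - X]RintegralZl//; last first.
  exact: integrable_itv.
rewrite -/(itv_int _ _ _) itv_int_trig// mulr0 subr0 mulrC ltr_pM2l; last first.
  by rewrite mulrn_wgt0// pi_gt0.
by rewrite ltrBlDr ltrDl mulr_gt0// exprn_gt0.
Qed.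

Lemma powR_expR (R : realType) (x p : R) : expR x `^ p = expR (p * x).
Proof. by rewrite /powR gt_eqF ?expR_gt0// expRK. Qed.

(** This serves for the vertical sides of a long rectangle in the Phragmen-Lindelof argument. *)
Lemma double_exp_dominates (R : realType) (rho rho' b c C M : R) :
  0 <= rho -> rho < rho' -> 0 < c -> 0 < M -> 0 <= b -> 0 <= C ->
  exists L0, forall L, L0 <= L ->
    C * expR (b * expR (rho * L) - c * expR (rho' * L)) <= M.
Proof.
move=> rho0 rr c0 M0 b0 C0; pose K := C / M.
have K0 : 0 <= K by rewrite divr_ge0// ltW.
have rr0 : 0 < rho' - rho by rewrite subr_gt0.
have bK0 : 0 <= (b + K) / c by rewrite divr_ge0 ?addr_ge0// ltW.
(* From this L on, c e^(rho' L) >= (b + K) e^(rho L), so the exponent is at most - K, and C e^(- K)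
   <= M because K <= e^K. *)
exists ((b + K) / c / (rho' - rho)) => L HL.
have L0 : 0 <= L by rewrite (le_trans _ HL)// divr_ge0// ltW.
have e1 : (b + K) / c <= expR ((rho' - rho) * L).
  rewrite (@le_trans _ _ (1 + (rho' - rho) * L)) ?expR_ge1Dx//.
  by rewrite ler_wpDl// -ler_pdivrMl// mulrC.
have e2 : (b + K) * expR (rho * L) <= c * expR (rho' * L).
  have -> : expR (rho' * L) = expR (rho * L) * expR ((rho' - rho) * L).
    by rewrite -expRD; congr expR; ring.
  by rewrite mulrC mulrCA ler_pM2l ?expR_gt0// -ler_pdivrMl// mulrC.
have e3 : 1 <= expR (rho * L) by rewrite -expR0 ler_expR mulr_ge0.
have e4 : b * expR (rho * L) - c * expR (rho' * L) <= - K.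
  have : K * 1 <= K * expR (rho * L) by rewrite ler_wpM2l.
  by move: e2; lra.
rewrite (@le_trans _ _ (C * expR (- K)))//; first by rewrite ler_wpM2l// ler_expR.
rewrite expRN ler_pdivrMr ?expR_gt0// mulrC -ler_pdivrMr// -/K.
by rewrite (le_trans _ (expR_ge1Dx _))// lerDr.
Qed.

(** The limit d -> 0 that removes an auxiliary factor, obtained from e^(- d k) >= 1 - d k. *)
Lemma le_of_expR_le (R : realType) (u k M : R) : 0 <= u -> 0 <= k ->
  (forall d, 0 < d -> expR (- (d * k)) * u <= M) -> u <= M.
Proof.
move=> u0 k0 key; apply/ler_addgt0Pr => e e0.
have ku0 : 0 <= k * u by exact: mulr_ge0.
have d0 : 0 < e / (k * u + 1) by rewrite divr_gt0// ltr_wpDl.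
have := key _ d0; set d := e / _.
have de : k * u * d <= e.
  have -> : e = (k * u) * d + d.
    by rewrite /d; field; rewrite gt_eqF// ltr_wpDl.
  by rewrite lerDl ltW.
have := expR_ge1Dx (- (d * k)).
by move=> /(ler_wpM2r u0) h1 h2; have := le_trans h1 h2; move: de; lra.
Qed.

(** The classical multiplier exp(- 2 d cosh(rho (w - i vc))) for a strip with centre line Im w =
    vc. *)
Definition strip_mult (R : realType) (rho vc d : R) (w : R[i]^o) : R[i]^o :=
  cexp (- d%:C * (cexp (rho%:C * (w - vc*i)) + cexp (- rho%:C * (w - vc*i)))).

Lemma differentiable_strip_mult (R : realType) (rho vc d : R) (w : R[i]^o) :
  differentiable (strip_mult rho vc d) w.
Proof.
have dl (c : R[i]) : differentiable (fun w : R[i]^o => cexp (c * (w - vc*i))) w.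
  apply: (@differentiable_comp _ _ _ _ (fun w : R[i]^o => c * (w - vc*i) : R[i]^o)).
    by apply: (@differentiableM _ (R[i]^o) (cst c) (fun w : R[i]^o => w - vc*i : R[i])).
  exact: differentiable_cexp.
apply: (@differentiable_comp _ _ _ _ (fun w : R[i]^o =>
  - d%:C * (cexp (rho%:C * (w - vc*i)) + cexp (- rho%:C * (w - vc*i))) : R[i]^o)).
  have dsum : differentiable (fun w : R[i]^o =>
      (cexp (rho%:C * (w - vc*i)) + cexp (- rho%:C * (w - vc*i)) : R[i]^o)) w.
    by apply: differentiableD; exact: dl.
  apply: (@differentiableM _ _ (cst (- d%:C)) _ _ _ dsum).
  exact: differentiable_cst.
exact: differentiable_cexp.
Qed.

Lemma normc_strip_mult (R : realType) (rho vc d u v p : R) :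
  Normc.normc (strip_mult rho vc d (u +i* v)) `^ p =
  expR (- (p * d * cos (rho * (v - vc)) *
           (expR (rho * u) + expR (- (rho * u))))).
Proof.
rewrite /strip_mult normc_cexp powR_expR; congr expR.
rewrite /cexp /= !(mul0r, subr0, mulr0, oppr0, addr0, add0r) mulNr.
rewrite (mulNr rho (v - vc)) cosN (mulNr rho u); ring.
Qed.

(** The multiplier of rate rho' > rho beats the growth of U on remote vertical sides, and rho' (v2 -
    v1) < pi keeps its cosine positive up to the edges, where its modulus is at most 1. *)
Lemma phragmen_lindelof_strip (R : realType) (p : R) (U : R[i]^o -> R)
    (v1 v2 rho rho' b C M : R) : 0 < p ->
  log_subharmonic p U -> v1 < v2 -> 0 <= rho -> rho < rho' ->
  rho' * (v2 - v1) < pi -> 0 < M -> 0 <= b -> 0 <= C ->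
  (forall u, U (u +i* v1) <= M) -> (forall u, U (u +i* v2) <= M) ->
  (forall u v, v1 <= v <= v2 -> U (u +i* v) <= C * expR (b * expR (rho * `|u|))) ->
  forall u v, v1 <= v <= v2 -> U (u +i* v) <= M.
Proof.
move=> p0 sU v12 rho0 rr rpi M0 b0 C0 U1 U2 UC u0 v0 hv0.
have [_ U0 _] := sU.
have rho'0 : 0 < rho' := le_lt_trans rho0 rr.
pose vc := (v1 + v2) / 2.
pose c0 := cos (rho' * ((v2 - v1) / 2)).
have pi0 := pi_gt0 R.
have c00 : 0 < c0.
  apply: cos_gt0_pihalf.
  have : 0 < rho' * ((v2 - v1) / 2) by rewrite mulr_gt0// divr_gt0// subr_gt0.
  by rewrite mulrA; lra.
have cosge v : v1 <= v <= v2 -> c0 <= cos (rho' * (v - vc)).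
  move=> hv; rewrite -cos_norm normrM (gtr0_norm rho'0).
  have h : `|v - vc| <= (v2 - v1) / 2 by rewrite ler_norml /vc; lra.
  have h' : 0 <= `|v - vc| by [].
  have m1 : rho' * `|v - vc| <= rho' * ((v2 - v1) / 2) by rewrite ler_pM2l.
  have m2 : 0 <= rho' * `|v - vc| by rewrite mulr_ge0// ltW.
  have m3 : rho' * ((v2 - v1) / 2) <= pi by rewrite mulrA; lra.
  by rewrite /c0 leNgt ltr_cos -?leNgt// in_itv/=; lra.
pose A := cos (rho' * (v0 - vc)) * (expR (rho' * u0) + expR (- (rho' * u0))).
have A0 : 0 <= A.
  rewrite mulr_ge0 ?addr_ge0 ?expR_ge0// (le_trans (ltW c00))//; exact: cosge.
have key d : 0 < d -> expR (- (p * d * A)) * U (u0 +i* v0) <= M.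
  move=> d0; have c'0 : 0 < p * d * c0 by rewrite !mulr_gt0.
  have [L0 HL0] := double_exp_dominates rho0 rr c'0 M0 b0 C0.
  (* L0 takes care of the vertical sides, |u0| puts the given point into the rectangle, and 1 makes
     L positive. *)
  pose L := Num.max L0 (Num.max `|u0| 1).
  have L0L : L0 <= L by rewrite le_max lexx.
  have uL : `|u0| <= L by rewrite !le_max lexx !orbT.
  have L_gt0 : 0 < L by rewrite !lt_max ltr01 !orbT.
  have := @max_principle _ _ _ (- L) L v1 v2 M
    (log_subharmonicM p0 (differentiable_strip_mult rho' vc d) sU).
  case/(_ _)/Wrap; last first.
    move=> /(_ u0 v0); rewrite normc_strip_mult -[p * d * cos _ * _]mulrA -/A.
    by apply=> //; rewrite -ler_norml.
  move=> u v hu hv; rewrite normc_strip_mult.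
  have cc := cosge _ hv.
  have c_ge0 := le_trans (ltW c00) cc.
  have le1 : expR (- (p * d * cos (rho' * (v - vc)) *
      (expR (rho' * u) + expR (- (rho' * u))))) <= 1.
    rewrite -expR0 ler_expR oppr_le0 !mulr_ge0// ?addr_ge0 ?expR_ge0//; exact: ltW.
  have side : `|u| = L ->
      expR (- (p * d * cos (rho' * (v - vc)) *
        (expR (rho' * u) + expR (- (rho' * u))))) * U (u +i* v) <= M.
    move=> uL'; apply: le_trans (HL0 _ L0L).
    rewrite [b * _ - _]addrC expRD [C * _]mulrCA ler_pM ?expR_ge0//; last first.
      by have := UC u v hv; rewrite uL'.
    rewrite ler_expR lerN2 -(mulrA (p * d)) -(mulrA (p * d)).
    rewrite ler_pM2l ?mulr_gt0// ler_pM ?expR_ge0 ?(ltW c00)// -uL'.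
    by case: (ger0P u) => _; rewrite ?mulrN ?lerDl ?lerDr expR_ge0.
  move=> /or4P[] /eqP e; rewrite e in hu hv le1 cc c_ge0 side *.
  - by rewrite side// normrN gtr0_norm.
  - by rewrite side// gtr0_norm.
  - by rewrite (le_trans _ (U1 u))// ler_piMl.
  - by rewrite (le_trans _ (U2 u))// ler_piMl.
have pA0 : 0 <= p * A by rewrite mulr_ge0// ltW.
apply: (le_of_expR_le (U0 _) pA0) => d /key.
by rewrite (_ : d * (p * A) = p * d * A)//; ring.
Qed.

(** * Measurability of continuous functions *)

(* The measurability of continuous functions of several real variables is
   obtained by rounding the arguments to countably many values. *)
Definition countably_coded d (T : measurableType d) (a : T -> T) :=
  exists (D : countType) (c : T -> D) (g : D -> T),
    (forall u, a u = g (c u)) /\ forall x, measurable (c @^-1` [set x]).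

(** The composite depends on u only through [c u], so every preimage is a countable union of fibres
    of c, whatever f is. *)
Lemma measurable_countably_coded d (T : measurableType d) (R : realType)
    (a : T -> T) (f : T -> R) :
  countably_coded a -> measurable_fun setT (f \o a).
Proof.
move=> [D [c [g [aE mc]]]] _ Y mY; rewrite setTI.
pose B (n : nat) := if unpickle n is Some x then
  (if `[< Y (f (g x)) >] then c @^-1` [set x] else set0) else set0.
rewrite (_ : _ @^-1` _ = \bigcup_n B n).
  apply: bigcup_measurable => n _; rewrite /B; case: unpickle => [x|]//.
  by case: asboolP.
apply/seteqP; split=> [u /= Yu|u [n _]].
  exists (pickle (c u)) => //; rewrite /B pickleK asboolT//= -aE//.
rewrite /B; case: unpickle => [x|]//; case: asboolP => //= Yx cu.
by rewrite aE cu.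
Qed.

Lemma measurable_of_roundings d (T : measurableType d) (R : realType)
    (a : nat -> T -> T) (f : T -> R) :
  (forall k, countably_coded (a k)) ->
  (forall u, f (a k u) @[k --> \oo] --> f u) -> measurable_fun setT f.
Proof.
move=> ca fa.
apply: (@measurable_realfun.measurable_fun_cvg _ _ _ _ (fun k => f \o a k)).
  by move=> k; exact: measurable_countably_coded.
by move=> u _; exact: fa.
Qed.

Lemma countably_coded_pair d1 d2 (T1 : measurableType d1) (T2 : measurableType d2)
    (a1 : T1 -> T1) (a2 : T2 -> T2) :
  countably_coded a1 -> countably_coded a2 ->
  countably_coded (fun u : T1 * T2 => (a1 u.1, a2 u.2)).
Proof.
move=> [D1 [c1 [g1 [aE1 mc1]]]] [D2 [c2 [g2 [aE2 mc2]]]].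
exists (D1 * D2)%type, (fun u => (c1 u.1, c2 u.2)), (fun x => (g1 x.1, g2 x.2)).
split=> [u|[x1 x2]]; first by rewrite aE1 aE2.
rewrite (_ : _ @^-1` _ = (c1 @^-1` [set x1]) `*` (c2 @^-1` [set x2])).
  exact: measurableX.
by apply/seteqP; split=> -[u1 u2] /= [-> ->].
Qed.

Lemma countably_coded_map_tuple d (T : measurableType d) n (a : T -> T) :
  countably_coded a -> countably_coded (@map_tuple n T T a).
Proof.
move=> [D [c [g [aE mc]]]].
exists (n.-tuple D), (map_tuple c), (map_tuple g); split=> [u|x].
  by apply: eq_from_tnth => i; rewrite !tnth_map aE.
rewrite (_ : _ @^-1` _ =
  \bigcap_(i in [set: 'I_n]) ((fun u : n.-tuple T => tnth u i) @^-1`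
     (c @^-1` [set tnth x i]))).
  rewrite -[X in measurable X]setCK setC_bigcap; apply: measurableC.
  apply: fin_bigcup_measurable => // i _; apply: measurableC.
  by rewrite -[X in measurable X]setTI; exact: measurable_tnth.
apply/seteqP; split=> u /=.
  by move=> <- i _ /=; rewrite tnth_map.
by move=> H; apply: eq_from_tnth => i; rewrite tnth_map; exact: H.
Qed.

Definition rounding (R : realType) (k : nat) (x : measurableTypeR R) :
    measurableTypeR R :=
  (Num.floor (x * k.+1%:R))%:~R / k.+1%:R.

Lemma countably_coded_rounding (R : realType) (k : nat) :
  countably_coded (@rounding R k).
Proof.
exists int, (fun x : R => Num.floor (x * k.+1%:R)), (fun m => m%:~R / k.+1%:R).
split=> // m.
rewrite (_ : _ @^-1` _ = `[m%:~R / k.+1%:R, (m + 1)%:~R / k.+1%:R[%classic)//.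
apply/seteqP; split=> x; rewrite /= in_itv/= ler_pdivrMr// ltr_pdivlMr//.
  by move=> <-; exact: floor_itv.
by move=> H; apply/eqP; rewrite floor_eq.
Qed.

Lemma cvg_rounding (R : realType) (x : R) : rounding k x @[k --> \oo] --> x.
Proof.
apply/cvgr_dist_ltP => e e0.
have := @near_infty_natSinv_lt R (PosNum e0).
apply: filterS => k /= ke; apply: le_lt_trans ke.
rewrite /rounding.
have /andP[h1 h2] := floor_itv (x * k.+1%:R).
have -> : x - (Num.floor (x * k.+1%:R))%:~R / k.+1%:R =
  (x * k.+1%:R - (Num.floor (x * k.+1%:R))%:~R) / k.+1%:R.
  by rewrite mulrBl mulfK.
rewrite normrM [X in _ * X]ger0_norm ?invr_ge0// ler_piMl ?invr_ge0//.
by move: h1 h2; rewrite intrD ler_norml; lra.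
Qed.

(** * The inequality on a line *)

Lemma measurable_continuous2 (R : realType) (g : R * R -> R) : continuous g ->
  measurable_fun setT (g : measurableTypeR R * measurableTypeR R -> R).
Proof.
move=> cg; apply: (@measurable_of_roundings _ _ _
  (fun k u => (rounding k u.1, rounding k u.2))) => [k|[x y]].
  by apply: countably_coded_pair; exact: countably_coded_rounding.
apply: (@cvg_comp _ _ _ (fun k => (rounding k x, rounding k y) : R * R) g);
  last exact: cg.
by apply: (@cvg_pair _ _ _ \oo (nbhs (x : R)) (nbhs (y : R))); exact: cvg_rounding.
Qed.

(** Compactness of [a, b] turns continuity of phi at the points (s, w) into an estimate uniform in
    s. *)
Lemma continuous_itv_int (R : realType) (T : topologicalType)
    (phi : R * T -> R) (a b : R) : a <= b -> continuous phi ->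
  continuous (fun w => itv_int a b (fun s => phi (s, w))).
Proof.
move=> ab cphi w.
have cs w' : continuous (fun s => phi (s, w')).
  exact: continuous_partial1.
apply/cvgr_dist_ltP => e e0.
(* The summand 1 covers a = b and leaves the final bound strictly below e. *)
have e'0 : 0 < e / (b - a + 1) by rewrite divr_gt0// ltr_wpDl// subr_ge0.
have e20 : 0 < e / (b - a + 1) / 2 by rewrite divr_gt0.
have /compact_near_coveringP := @segment_compact R a b.
move=> /(_ _ (nbhs w) (fun w' s => `|phi (s, w) - phi (s, w')| < e / (b - a + 1))).
case/(_ _ _)/Wrap => [s _|].
  have /cvgr_dist_ltP/(_ _ e20)[[A B] /= [As Bw] AB] := cphi (s, w).
  exists (A, B) => //= -[s' w'] /= [As' Bw'].
  have h1 := AB (s', w') (conj As' Bw').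
  have h2 := AB (s', w) (conj As' (nbhs_singleton Bw)).
  rewrite (_ : phi (s', w) - _ = (phi (s, w) - phi (s', w')) -
    (phi (s, w) - phi (s', w))); last by ring.
  by rewrite (le_lt_trans (ler_normB _ _))// [ltRHS]splitr ltrD.
apply: filterS => w' H; rewrite -itv_intB//.
have := @itv_int_dist _ (fun s => phi (s, w) - phi (s, w')) a b 0 _ _ ab.
move=> /(_ (e / (b - a + 1))); rewrite mul0r subr0.
case/(_ _ _)/Wrap => [|s hs|].
- by move=> s; apply: cvgB; exact: cs.
- by rewrite subr0 ltW//; apply: H; rewrite /= in_itv.
- move/le_lt_trans; apply; rewrite mulrAC ltr_pdivrMr ?ltr_wpDl ?subr_ge0//.
  by rewrite ltr_pM2l// ltrDl.
Qed.

Lemma itv_int_fubini (R : realType) (g : R * R -> R) (a b c d : R) :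
  a <= b -> c <= d -> continuous g -> (forall q, 0 <= g q) ->
  itv_int c d (fun y => itv_int a b (fun x => g (x, y))) =
  itv_int a b (fun x => itv_int c d (fun y => g (x, y))).
Proof.
move=> ab cd cg g0.
have cx y : continuous (fun x => g (x, y)).
  exact: continuous_partial1.
have cy x : continuous (fun y => g (x, y)).
  exact: continuous_partial2.
have cg' := continuous_swap_args cg.
apply: EFin_inj; rewrite itv_intE; last exact: continuous_itv_int.
rewrite itv_intE; last first.
  exact: (@continuous_itv_int _ _ (fun q => g (q.2, q.1))).
under eq_integral do rewrite itv_intE//.
under [RHS]eq_integral do rewrite itv_intE//.
pose mu := @lebesgue_measure R.
(* Extension by zero turns the integrals over intervals into integrals over the line, where Tonelli
   applies. *)
pose f : measurableTypeR R * measurableTypeR R -> \bar R :=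
  (fun q => (g q)%:E) \_ (`[a, b] `*` `[c, d]).
have mf : measurable_fun setT f.
  have mD : measurable (`[a, b]%classic `*` `[c, d]%classic :
      set (measurableTypeR R * measurableTypeR R)).
    by apply: measurableX; exact: measurable_itv.
  apply/(measurable_restrictT _ mD).
  apply: measurable_funTS; apply/measurable_EFinP.
  exact: (measurable_continuous2 cg).
have f0 q : (0 <= f q)%E.
  by rewrite /f patchE; case: ifPn => // _; rewrite lee_fin.
have H := fubini_tonelli (m1 := mu) (m2 := mu) f mf f0.
have fl x : (\int[mu]_y f (x, y) =
    ((fun x => \int[mu]_(y in `[c, d]) (g (x, y))%:E) \_ `[a, b]) x)%E.
  rewrite patchE; case: ifPn => xa; last first.
    rewrite integral0_eq// => y _; rewrite /f patchE ifF//.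
    by apply/negbTE; apply: contra xa; rewrite !inE => -[].
  rewrite [RHS]integral_mkcond; apply: eq_integral => y _; rewrite /f !patchE.
  by congr (if _ then _ else _); apply/idP/idP; rewrite !inE /=;
    [case|split=> //; rewrite inE in xa].
have fr y : (\int[mu]_x f (x, y) =
    ((fun y => \int[mu]_(x in `[a, b]) (g (x, y))%:E) \_ `[c, d]) y)%E.
  rewrite patchE; case: ifPn => xa; last first.
    rewrite integral0_eq// => x _; rewrite /f patchE ifF//.
    by apply/negbTE; apply: contra xa; rewrite !inE => -[].
  rewrite [RHS]integral_mkcond; apply: eq_integral => x _; rewrite /f !patchE.
  by congr (if _ then _ else _); apply/idP/idP; rewrite !inE /=;
    [case|split=> //; rewrite inE in xa].
rewrite [LHS]integral_mkcond [RHS]integral_mkcond.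
transitivity (\int[mu]_y \int[mu]_x f (x, y))%E.
  by apply: eq_integral => y _; rewrite fr.
by rewrite -H; apply: eq_integral => x _; rewrite fl.
Qed.

(** A multiplier m can be moved under the integral, where m times [Phi s] is again entire. Then
    [submean_powR] holds for each s, and Fubini exchanges s with the angle. *)
Lemma log_subharmonic_int (R : realType) (p a b : R)
    (Phi : R -> R[i]^o -> R[i]^o) : a <= b -> 1 < p ->
  (forall s w, differentiable (Phi s) w) ->
  continuous (fun q : R * R[i]^o => Phi q.1 q.2) ->
  log_subharmonic p (fun w => itv_int a b (fun s => Normc.normc (Phi s w) `^ p)).
Proof.
move=> ab p1 dPhi cPhi; have p0 : 0 < p by rewrite (lt_trans _ p1).
have pi2_ge0 : 0 <= pi *+ 2 :> R by rewrite mulrn_wge0// pi_ge0.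
have cn := continuous_normc_powR p0 cPhi.
have cs w : continuous (fun s => Normc.normc (Phi s w) `^ p).
  exact: (@continuous_partial1 _ _ _ _ w cn).
split.
- exact: (continuous_itv_int ab cn).
- by move=> w; apply: Rintegral_ge0 => s _; rewrite powR_ge0.
move=> m w0 r dm r0.
pose Psi s w := m w * Phi s w : R[i]^o.
have dPsi s w : differentiable (Psi s) w.
  by apply: (@differentiableM _ _ m (Phi s)); [exact: dm|exact: dPhi].
have cPsi : continuous (fun q : R * R[i]^o => Psi q.1 q.2).
  move=> q; apply: (@continuousM _ _ (fun q : R * R[i]^o => m q.2)
    (fun q : R * R[i]^o => Phi q.1 q.2) q); last exact: cPhi.
  apply: (@continuous_comp _ _ _ snd m); first exact: cvg_snd.
  exact: continuous_entire.
have E w : Normc.normc (m w) `^ p * itv_int a b (fun s => Normc.normc (Phi s w) `^ p) =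
    itv_int a b (fun s => Normc.normc (Psi s w) `^ p).
  rewrite /itv_int -RintegralZl//; last exact: integrable_itv.
  by apply: eq_Rintegral => s _; rewrite /Psi Normc.normcM powRM ?normc_ge0.
rewrite E /itv_int; under [leRHS]eq_Rintegral do rewrite E.
rewrite -!/(itv_int _ _ _).
pose g (q : R * R) := Normc.normc (Psi q.1 (w0 + circ r q.2)) `^ p.
have cg : continuous g.
  apply: continuous_normc_powR => // q.
  apply: (@continuous_after _ _ _ (fun q : R * R[i]^o => Psi q.1 q.2)
    (fun q : R * R => (q.1, w0 + circ r q.2)) cPsi).
  apply: continuous_pair; first exact: continuous_proj1.
  apply: continuous_add; first exact: continuous_const.
  by apply: continuous_after; [exact: continuous_circ|exact: continuous_proj2].
have := @itv_int_fubini _ g a b 0 (pi *+ 2) ab pi2_ge0 cg (fun q => powR_ge0 _ _).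
rewrite /g/= => ->.
have cPs : continuous (fun s => Normc.normc (Psi s w0) `^ p).
  exact: (@continuous_partial1 _ _ _ _ w0 (continuous_normc_powR p0 cPsi)).
rewrite [leLHS](_ : _ = itv_int a b (fun s => pi *+ 2 * Normc.normc (Psi s w0) `^ p)).
  apply: le_itv_int.
  - by move=> s; apply: cvgMr; exact: cPs.
  - by apply: (@continuous_itv_int _ _ (fun q => g (q.2, q.1))) => //;
      exact: continuous_swap_args.
  - by move=> s _; exact: submean_powR.
by rewrite /itv_int RintegralZl//; exact: integrable_itv.
Qed.

(** * Phragmen-Lindelof in the lower half-plane *)

Section half_plane.
Variables (R : realType) (G : R[i]^o -> R[i]^o) (A C p S M : R).
Hypothesis dG : forall w, differentiable G w.
Hypotheses (A0 : 0 < A) (C0 : 0 < C) (p1 : 1 < p) (S0 : 0 < S) (M0 : 0 < M).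
Hypothesis G_le : forall t h,
  Normc.normc (G (t +i* h)) <= C * expR (A * (`|t| + `|h|)).
Hypothesis G_real : forall t0,
  itv_int (- S) S (fun s => Normc.normc (G ((s + t0) +i* 0)) `^ p) <= M.

(* -i e^w maps the strip |Im w| < pi / 2 onto the lower half-plane, and the
   factor exp (- A e^w) compensates the exponential growth along its axis. *)
Let Phi (s : R) (w : R[i]^o) : R[i]^o :=
  cexp (- A%:C * cexp w) * G (- 'i%C * cexp w + s%:C).

Let U (w : R[i]^o) := itv_int (- S) S (fun s => Normc.normc (Phi s w) `^ p).

Let dlin (c d w : R[i]^o) :
  differentiable (fun w : R[i]^o => c * cexp w + d : R[i]^o) w.
Proof.
apply: (@differentiableD _ _ _ (fun w : R[i]^o => c * cexp w : R[i]^o) (cst d)) => //.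
by apply: (@differentiableM _ _ (cst c) (@cexp R)) => //; exact: differentiable_cexp.
Qed.

Let dPhi s w : differentiable (Phi s) w.
Proof.
apply: (@differentiableM _ _ (fun w => cexp (- A%:C * cexp w))
    (fun w => G (- 'i%C * cexp w + s%:C))).
  apply: (@differentiable_comp _ _ _ _ (fun w : R[i]^o => - A%:C * cexp w : R[i]^o)).
    under eq_fun do rewrite -[- A%:C * _]addr0.
    exact: dlin.
  exact: differentiable_cexp.
apply: (@differentiable_comp _ _ _ _
  (fun w : R[i]^o => - 'i%C * cexp w + s%:C : R[i]^o)).
  exact: dlin.
exact: dG.
Qed.

Let cPhi : continuous (fun q : R * R[i]^o => Phi q.1 q.2).
Proof.
have cR : continuous (fun s : R => s%:C : R[i]^o).
  by move=> s; apply: cvg_Complex; [exact: cvg_id|exact: cvg_cst].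
have cE : continuous (fun w : R[i]^o => - 'i%C * cexp w : R[i]^o).
  move=> w; apply: differentiable_continuous.
  by under eq_fun do rewrite -[- 'i%C * _]addr0; exact: dlin.
have cF : continuous (fun w : R[i]^o => cexp (- A%:C * cexp w) : R[i]^o).
  move=> w; apply: differentiable_continuous.
  apply: (@differentiable_comp _ _ _ _ (fun w : R[i]^o => - A%:C * cexp w : R[i]^o)).
    under eq_fun do rewrite -[- A%:C * _]addr0.
    exact: dlin.
  exact: differentiable_cexp.
have cG : continuous (fun q : R * R[i]^o => G (- 'i%C * cexp q.2 + q.1%:C)).
  apply: (@continuous_after _ _ _ G); first exact: continuous_entire.
  apply: (@continuous_add _ R[i]^o).
    exact: (continuous_after cE (@continuous_proj2 _ _)).
  exact: (continuous_after cR (@continuous_proj1 _ _)).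
move=> q; apply: (@continuousM _ _ (fun q : R * R[i]^o => cexp (- A%:C * cexp q.2))
  (fun q : R * R[i]^o => G (- 'i%C * cexp q.2 + q.1%:C)) q); last exact: cG.
exact: (continuous_after cF (@continuous_proj2 _ _)).
Qed.

Let sU : log_subharmonic p U.
Proof.
apply: log_subharmonic_int => //.
by rewrite -subr_ge0 opprK addr_ge0// ltW.
Qed.

Let normc_Phi s u v : Normc.normc (Phi s (u +i* v)) =
  expR (- (A * (expR u * cos v))) *
  Normc.normc (G ((s + expR u * sin v) +i* (- (expR u * cos v)))).
Proof.
rewrite /Phi Normc.normcM normc_cexp; congr (expR _ * Normc.normc (G _)).
  by rewrite /= mulNr oppr0 mul0r subr0.
apply/eqP; rewrite eq_complex /=; apply/andP; split; apply/eqP; ring.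
Qed.

Let p0 : 0 < p. Proof. exact: lt_trans p1. Qed.

(** A bound for U on the real axis of the strip: the length 2 S times a bound for |Phi s|^p when |s|
    <= S. *)
Let C1 := (S - - S) * (C * expR (A * S)) `^ p.

Let C1_gt0 : 0 < C1.
Proof.
by rewrite mulr_gt0 ?opprK ?addr_gt0// powR_gt0// mulr_gt0// expR_gt0.
Qed.

(** The multiplier cancels exactly the growth in the imaginary part of the argument of G, which is -
    e^u cos v; only the real part s + e^u sin v still counts. *)
Let U_le u v : 0 <= cos v ->
  U (u +i* v) <= C1 * expR (p * A * (expR u * `|sin v|)).
Proof.
move=> cv.
have SS : - S <= S by rewrite -subr_ge0 opprK addr_ge0// ltW.
pose k := (C * expR (A * S)) `^ p * expR (p * A * (expR u * `|sin v|)).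
suff : U (u +i* v) <= itv_int (- S) S (cst k).
  rewrite itv_int_cst//; congr (_ <= _); rewrite /k /C1; ring.
apply: le_itv_int => [||s /andP[s1 s2]].
- exact: (@continuous_partial1 _ _ _ _ (u +i* v : R[i]^o)
    (continuous_normc_powR p0 cPhi)).
- exact: continuous_const.
rewrite /k -[p * A * _]mulrA -(powR_expR (A * (expR u * `|sin v|)) p).
rewrite -powRM ?expR_ge0 ?mulr_ge0 ?(ltW C0) ?expR_ge0//.
apply: ge0_ler_powR; rewrite ?nnegrE ?(ltW p0) ?normc_ge0//.
  by apply: mulr_ge0; [exact: mulr_ge0 (ltW C0) (expR_ge0 _)|exact: expR_ge0].
rewrite normc_Phi.
have e0 := expR_ge0 u.
rewrite (@le_trans _ _ (expR (- (A * (expR u * cos v))) *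
    (C * expR (A * (`|s + expR u * sin v| + `|- (expR u * cos v)|)))))//.
  by rewrite ler_pM2l ?expR_gt0.
rewrite mulrCA -!mulrA ler_pM2l// -!expRD ler_expR.
rewrite normrN (ger0_norm (mulr_ge0 e0 cv)).
have -> : - (A * (expR u * cos v)) + A * (`|s + expR u * sin v| + expR u * cos v) =
  A * `|s + expR u * sin v| by ring.
rewrite -mulrDr ler_pM2l// (le_trans (ler_normD _ _))// normrM (ger0_norm e0).
by rewrite lerD2r ler_norml s1.
Qed.

(** The multiplier has modulus 1 and G is evaluated on a real segment moved by e^u sin v; this is
    why [G_real] is uniform in t0. *)
Let U_real u v : cos v = 0 -> U (u +i* v) <= M.
Proof.
move=> cv; rewrite (le_trans _ (G_real (expR u * sin v)))//.
rewrite /U /itv_int.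
under eq_Rintegral do rewrite normc_Phi cv !mulr0 oppr0 expR0 mul1r.
by [].
Qed.

Let U_bounded u v : - (pi / 2) <= v <= pi / 2 -> U (u +i* v) <= Num.max M C1.
Proof.
have pi0 := pi_gt0 R.
move=> /andP[v1 v2].
have hM : 0 < Num.max M C1 by rewrite lt_max M0.
have hC v' : cos v' = 0 -> forall u, U (u +i* v') <= Num.max M C1.
  by move=> ? u'; rewrite (le_trans (U_real _ _))// le_max lexx.
have h0 u' : U (u' +i* 0) <= Num.max M C1.
  rewrite (le_trans (U_le _ _)) ?cos0// sin0 normr0 !mulr0 expR0 mulr1.
  by rewrite le_max lexx orbT.
have hg u' v' : - (pi / 2) <= v' <= pi / 2 ->
    U (u' +i* v') <= C1 * expR (p * A * expR (1 * `|u'|)).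
  move=> hv'; rewrite (le_trans (U_le _ _)) ?cos_ge0_pihalf//.
  rewrite ler_pM2l// ler_expR ler_pM2l ?mulr_gt0// mul1r.
  rewrite (@le_trans _ _ (expR u'))//; last by rewrite ler_expR ler_norm.
  by rewrite ler_piMr ?expR_ge0// ler_norml sin_geN1 sin_le1.
have b0 : 0 <= p * A by rewrite mulr_ge0// ltW.
(* The rate must exceed the growth rate 1 and stay below 2, as the half-strips have width pi/2. *)
have r32 : 1 < 3 / 2 :> R by lra.
have pi20 : 0 < pi / 2 :> R by lra.
have Npi20 : - (pi / 2) < 0 :> R by lra.
have rpi : 3 / 2 * (pi / 2 - 0) < pi :> R by lra.
have Nrpi : 3 / 2 * (0 - - (pi / 2)) < pi :> R by lra.
have hC1 := hC _ (@cos_pihalf R).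
have hC2 : forall u, U (u +i* - (pi / 2)) <= Num.max M C1.
  by apply: hC; rewrite cosN cos_pihalf.
have hg1 u' v' : 0 <= v' <= pi / 2 ->
    U (u' +i* v') <= C1 * expR (p * A * expR (1 * `|u'|)).
  by move=> hv'; apply: hg; lra.
have hg2 u' v' : - (pi / 2) <= v' <= 0 ->
    U (u' +i* v') <= C1 * expR (p * A * expR (1 * `|u'|)).
  by move=> hv'; apply: hg; lra.
have [v0|v0] := leP 0 v.
  apply: (phragmen_lindelof_strip p0 sU pi20 ler01 r32 rpi hM b0 (ltW C1_gt0)
    h0 hC1 hg1).
  by rewrite v0.
apply: (phragmen_lindelof_strip p0 sU Npi20 ler01 r32 Nrpi hM b0 (ltW C1_gt0)
  hC2 h0 hg2).
by rewrite v1 ltW.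
Qed.

Lemma half_plane_bound y : 0 < y ->
  itv_int (- S) S (fun s => Normc.normc (G (s +i* - y)) `^ p) <=
  expR (p * A * y) * M.
Proof.
move=> y0; have pi0 := pi_gt0 R.
have hM : 0 < Num.max M C1 by rewrite lt_max M0.
have Npipi : - (pi / 2) < pi / 2 :> R by lra.
(* U is now known to be bounded, so the growth rate is 0 and any rate strictly between 0 and 1 suits
   the width pi. *)
have r12 : 0 < 1 / 2 :> R by lra.
have rpi : 1 / 2 * (pi / 2 - - (pi / 2)) < pi :> R by lra.
have U1 u : U (u +i* - (pi / 2)) <= M by apply: U_real; rewrite cosN cos_pihalf.
have U2 u : U (u +i* (pi / 2)) <= M by apply: U_real; rewrite cos_pihalf.
have UC u v : - (pi / 2) <= v <= pi / 2 ->
    U (u +i* v) <= Num.max M C1 * expR (0 * expR (0 * `|u|)).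
  by move=> hv; rewrite mul0r expR0 mulr1; exact: U_bounded.
(* At w = ln y the point - i e^w is - i y and the multiplier is e^(- A y). *)
have UM : U (ln y +i* 0) <= M.
  apply: (phragmen_lindelof_strip p0 sU Npipi (lexx 0) r12 rpi M0 (lexx 0)
    (ltW hM) U1 U2 UC).
  by lra.
have cs : continuous (fun s => Normc.normc (G (s +i* - y)) `^ p).
  apply: continuous_normc_powR => //.
  apply: (@continuous_after _ _ _ G (fun s : R => s +i* - y : R[i]^o)).
    exact: continuous_entire.
  by move=> s; apply: cvg_Complex; [exact: cvg_id|exact: cvg_cst].
have UE : U (ln y +i* 0) = expR (- (p * A * y)) *
    itv_int (- S) S (fun s => Normc.normc (G (s +i* - y)) `^ p).
  rewrite /itv_int -RintegralZl//; last exact: integrable_itv.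
  apply: eq_Rintegral => s _.
  rewrite normc_Phi lnK// cos0 sin0 mulr0 mulr1 addr0.
  by rewrite powRM ?expR_ge0 ?normc_ge0// powR_expR mulrN mulrA.
by move: UM; rewrite UE expRN ler_pdivrMl ?expR_gt0.
Qed.

End half_plane.

Lemma lebesgue_measure_shift (R : realType) (c : R) (A : set R) : measurable A ->
  pushforward lebesgue_measure
    (fun x : measurableTypeR R => x + c : measurableTypeR R) A =
  lebesgue_measure A.
Proof.
move=> mA; have mshift : measurable_fun setT
    (fun x : measurableTypeR R => x + c : measurableTypeR R).
  exact: measurable_funD.
apply/esym; apply: (@lebesgue_measure_unique R (pushforward lebesgue_measure
  (fun x : measurableTypeR R => x + c : measurableTypeR R))) => //= _ [[a b]] _ <-.
rewrite /pushforward.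
rewrite (_ : _ @^-1` _ = `]a - c, b - c]%classic); last first.
  by apply/seteqP; split=> x; rewrite /= !in_itv/= ltrBlDr lerBrDr.
rewrite !lebesgue_measure_itv/= !lte_fin ltrD2r -!EFinB.
by case: ifP => // _; congr _%:E; ring.
Qed.

Lemma ge0_integral_shift (R : realType) (c : R) (f : measurableTypeR R -> \bar R) :
  measurable_fun setT f -> (forall x, 0 <= f x)%E ->
  (\int[lebesgue_measure]_x f (x + c)%R = \int[lebesgue_measure]_x f x)%E.
Proof.
move=> mf f0.
have mshift : measurable_fun setT
    (fun x : measurableTypeR R => x + c : measurableTypeR R).
  exact: measurable_funD.
have := @ge0_integral_pushforward _ _ _ _ R _ mshift lebesgue_measure setT f.
move=> /(_ measurableT mf (fun y _ => f0 y)).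
rewrite preimage_setT => /esym.
rewrite -[X in X = _ -> _]/(\int[lebesgue_measure]_x f (x + c)%R)%E => ->.
apply: eq_measure_integral => A mA _; exact: lebesgue_measure_shift.
Qed.

Section line.
Variables (R : realType) (G : R[i]^o -> R[i]^o) (a p y : R).
Hypotheses (a0 : 0 < a) (p1 : 1 < p) (dG : forall w, differentiable G w).
Hypothesis G_le : forall eps, 0 < eps -> exists2 C, 0 < C & forall t h,
  Normc.normc (G (t +i* h)) <= C * expR ((a + eps) * (`|t| + `|h|)).
Hypothesis y0 : 0 < y.

Let p0 : 0 < p. Proof. exact: lt_trans p1. Qed.

Let cG h : continuous (fun s => Normc.normc (G (s +i* h)) `^ p).
Proof.
apply: continuous_normc_powR => //.
apply: (@continuous_after _ _ _ G (fun s : R => s +i* h : R[i]^o)).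
  exact: continuous_entire.
by move=> s; apply: cvg_Complex; [exact: cvg_id|exact: cvg_cst].
Qed.

(** Here eps tends to 0 in [half_plane_bound]; [le_of_expR_le] absorbs the factor e^(eps p y). *)
Lemma segment_bound (B S : R) : 0 <= B -> 0 < S ->
  (forall t0, itv_int (- S) S (fun s => Normc.normc (G ((s + t0) +i* 0)) `^ p) <= B) ->
  itv_int (- S) S (fun s => Normc.normc (G (s +i* - y)) `^ p) <=
    expR (a * p * y) * B.
Proof.
move=> B0 S0 BS; rewrite -ler_pdivrMl ?expR_gt0// -expRN.
have I0 : 0 <= itv_int (- S) S (fun s => Normc.normc (G (s +i* - y)) `^ p).
  by apply: Rintegral_ge0 => s _; rewrite powR_ge0.
have py0 : 0 <= p * y by rewrite mulr_ge0// ltW.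
apply: (le_of_expR_le (mulr_ge0 (expR_ge0 _) I0) py0).
(* [half_plane_bound] asks for a positive bound and B may vanish, hence B + eta. *)
move=> eps eps0; apply/ler_addgt0Pr => eta eta0.
have [C C0 GC] := G_le eps0.
have aeps : 0 < a + eps by rewrite addr_gt0.
have Beta : 0 < B + eta by rewrite ltr_wpDl.
have BS' t0 : itv_int (- S) S (fun s => Normc.normc (G ((s + t0) +i* 0)) `^ p) <=
    B + eta.
  by rewrite (le_trans (BS t0))// lerDl ltW.
have := half_plane_bound dG aeps C0 p1 S0 Beta GC BS' y0.
rewrite -ler_pdivrMl ?expR_gt0// -expRN.
by rewrite mulrA -expRD; congr (expR _ * _ <= _); ring.
Qed.

Let mG h : measurable_fun setT
  (fun s : measurableTypeR R => (Normc.normc (G (s +i* h)) `^ p)%:E).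
Proof. by apply/measurable_EFinP; exact: continuous_measurable_fun. Qed.

Let G0 h s : (0 <= (Normc.normc (G (s +i* h)) `^ p)%:E)%E.
Proof. by rewrite lee_fin powR_ge0. Qed.

(** Translation invariance of Lebesgue measure gives the uniformity in t0 that [segment_bound]
    requires. *)
Lemma shifted_segment_le (S t0 : R) :
  ((itv_int (- S) S (fun s => Normc.normc (G ((s + t0) +i* 0)) `^ p))%:E <=
   \int[lebesgue_measure]_t (Normc.normc (G (t +i* 0)) `^ p)%:E)%E.
Proof.
have cGt : continuous (fun s => Normc.normc (G ((s + t0) +i* 0)) `^ p).
  apply: (@continuous_after _ _ _ (fun s => Normc.normc (G (s +i* 0)) `^ p)) => //.
  by move=> s; apply: cvgD; [exact: cvg_id|exact: cvg_cst].
have shiftE := ge0_integral_shift t0 (mG 0) (G0 0).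
rewrite (itv_intE _ _ cGt) -{}shiftE; apply: ge0_subset_integral => //.
by apply/measurable_EFinP; exact: continuous_measurable_fun.
Qed.

Lemma plancherel_polya_line :
  (\int[lebesgue_measure]_t (Normc.normc (G (t +i* - y)) `^ p)%:E <=
   (expR (a * p * y))%:E *
     \int[lebesgue_measure]_t (Normc.normc (G (t +i* 0)) `^ p)%:E)%E.
Proof.
have := shifted_segment_le.
have : (0 <= \int[lebesgue_measure]_t (Normc.normc (G (t +i* 0)) `^ p)%:E)%E.
  by apply: integral_ge0 => s _; exact: G0.
case: integral => [B| |]; first last.
- by rewrite leeNy_eq.
- by move=> _ _; rewrite gt0_muley ?leey// lte_fin expR_gt0.
rewrite lee_fin -EFinM => B0 BS.
(* Starting from k + 1 keeps the half-length S positive. *)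
pose F k := `[- k.+1%:R, k.+1%:R]%classic : set (measurableTypeR R).
have -> : [set: R] = \bigcup_k F k.
  apply/seteqP; split=> // x _; exists (Num.truncn `|x|) => //=.
  by rewrite /F /= in_itv/= -ler_norml ltW// truncnS_gt.
have ndF : nondecreasing_seq F.
  move=> i j ij; apply/subsetPset => x; rewrite /F /= !in_itv/= => /andP[x1 x2].
  have ijR : i.+1%:R <= j.+1%:R :> R by rewrite ler_nat.
  by rewrite (le_trans _ x1) ?lerN2// (le_trans x2).
have mF i : measurable (F i) by exact: measurable_itv.
have := @ge0_nondecreasing_set_cvg_integral _ _ _ F _ lebesgue_measure ndF mF
  (fun i => measurable_funTS (@mG (- y))) (fun i s _ => G0 (- y) s).
apply: cvge_le; apply: nearW => k.
rewrite -itv_intE// lee_fin segment_bound// => t0.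
by rewrite -lee_fin BS.
Qed.

End line.

(** * Slices and translations on the Heisenberg group *)

(* The canonical topology of row vectors is only found through the normed
   module structure. *)
Definition Crow (R : realType) (n : nat) : normedModType R[i] := 'rV[R[i]]_n.

Lemma cvg_row (R : realType) (n : nat) (T : Type) (F : set_system T)
    {FF : Filter F} (f : T -> Crow R n) (l : Crow R n) :
  (forall j, (f t ord0 j : R[i]^o) @[t --> F] --> (l ord0 j : R[i]^o)) ->
  f @ F --> l.
Proof.
move=> H; apply/cvg_ballP => e e0.
suff : \forall t \near F, forall j, ball (l ord0 j : R[i]^o) e (f t ord0 j).
  by apply: filterS => t Ht; split=> // i j; rewrite ord1; exact: Ht.
by apply: filter_forall => j; have /cvg_ballP := H j; exact.
Qed.

Lemma continuous_coord (R : realType) (n : nat) j :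
  continuous (fun z : Crow R n => z ord0 j : R[i]^o).
Proof. exact: coord_continuous. Qed.

Lemma continuous_sqnorm (R : realType) (n : nat) :
  continuous (@sqnorm R n : Crow R n -> R).
Proof.
rewrite /sqnorm; apply: continuous_big => [|j _]; first exact: add_continuous.
have cn : continuous (fun z : Crow R n => Normc.normc (z ord0 j)).
  by apply: continuous_normc; exact: continuous_coord.
exact: (continuous_mulr cn cn).
Qed.

Lemma continuous_slice (R : realType) (n : nat) (F : Cn1 R n -> R[i]^o) (h : R) :
  continuous F -> continuous (slice F h : Crow R n * R -> R[i]^o).
Proof.
move=> cF; apply: (@continuous_after _ _ _ F (fun q : Crow R n * R =>
  (q.1, q.2 +i* (4^-1 * sqnorm q.1 + h)) : Cn1 R n)) => //.
apply: continuous_pair; first exact: continuous_proj1.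
apply: continuous_Complex; first exact: continuous_proj2.
apply: continuous_add; last exact: continuous_const.
apply: continuous_mulr; first exact: continuous_const.
apply: (continuous_after (@continuous_sqnorm R n)); exact: continuous_proj1.
Qed.

Section measurable_heis.
Variables (R : realType) (n : nat).

Definition heis_rounding (k : nat) (u : heis_coord R n) : heis_coord R n :=
  (map_tuple (fun q => (rounding k q.1, rounding k q.2)) u.1, rounding k u.2).

Lemma countably_coded_heis_rounding k : countably_coded (heis_rounding k).
Proof.
apply: (@countably_coded_pair _ _ _ _
  (map_tuple (fun q => (rounding k q.1, rounding k q.2))) (rounding k)).
  apply: countably_coded_map_tuple.
  by apply: countably_coded_pair; exact: countably_coded_rounding.
exact: countably_coded_rounding.
Qed.

Lemma cvg_heis_rounding (u : heis_coord R n) :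
  heis_of_coord (heis_rounding k u) @[k --> \oo] -->
  (heis_of_coord u : Crow R n * R).
Proof.
apply: (@cvg_pair _ _ _ \oo (nbhs ((heis_of_coord u).1 : Crow R n))
  (nbhs (u.2 : R))).
  apply: cvg_row => j; rewrite /heis_of_coord mxE.
  under eq_cvg do rewrite mxE tnth_map.
  by apply: cvg_Complex; exact: cvg_rounding.
exact: cvg_rounding.
Qed.

Lemma measurable_heis_param (f : R * (Crow R n * R) -> R) : continuous f ->
  measurable_fun setT
    (fun x : measurableTypeR R * heis_coord R n => f (x.1, heis_of_coord x.2)).
Proof.
move=> cf; apply: (@measurable_of_roundings _ _ _
  (fun k x => (rounding k x.1, heis_rounding k x.2))) => [k|[t u]].
  apply: countably_coded_pair; first exact: countably_coded_rounding.
  exact: countably_coded_heis_rounding.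
apply: (@cvg_comp _ _ _ (fun k => (rounding k t, heis_of_coord (heis_rounding k u))
  : R * (Crow R n * R)) f); last exact: cf.
apply: (@cvg_pair _ _ _ \oo (nbhs (t : R)) (nbhs (heis_of_coord u : Crow R n * R))).
  exact: cvg_rounding.
exact: cvg_heis_rounding.
Qed.

Lemma measurable_heis (f : Crow R n * R -> R) : continuous f ->
  measurable_fun setT (fun u : heis_coord R n => f (heis_of_coord u)).
Proof.
move=> cf; apply: (@measurable_of_roundings _ _ _ heis_rounding) => [k|u].
  exact: countably_coded_heis_rounding.
apply: (@cvg_comp _ _ _ (fun k => heis_of_coord (heis_rounding k u)
  : Crow R n * R) f); last exact: cf.
exact: cvg_heis_rounding.
Qed.

End measurable_heis.

(** * Fubini and translation invariance for the Haar measure *)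

Section haar.
Variables (R : realType) (m : nat).

Let leb : {sigma_finite_measure set (measurableTypeR R) -> \bar R} :=
  @lebesgue_measure R.
Let leb2 := prod_measure leb leb.

Lemma haar_integral1 n (g : heis_coord R n -> \bar R) :
  measurable_fun setT g -> (forall u, 0 <= g u)%E ->
  (\int[haar R n]_u g u =
   \int[tuple_measure (prod_measure (@lebesgue_measure R) (@lebesgue_measure R)) n]_v
     \int[@lebesgue_measure R]_t g (v, t))%E.
Proof.
by move=> mg g0; exact: (fubini_tonelli1 (m1 := tuple_measure leb2 n) (m2 := leb)).
Qed.

Definition coord_cons (x y : R) (v : m.-tuple (measurableTypeR R * measurableTypeR R))
  (t : R) : heis_coord R m.+1 := (tcons ((x, y), v), t).

(** The first complex coordinate becomes the outer variable, since the translations by [c e_0, 0]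
    shift it and shift t by an amount that depends on it alone. *)
Lemma haar_integralS (g : heis_coord R m.+1 -> \bar R) :
  measurable_fun setT g -> (forall u, 0 <= g u)%E ->
  exists H : R -> R -> \bar R,
  [/\ forall x y, (0 <= H x y)%E,
      measurable_fun setT
        (fun q : measurableTypeR R * measurableTypeR R => H q.1 q.2),
      forall x y, H x y = (\int[tuple_measure leb2 m]_v \int[leb]_t
        g (coord_cons x y v t))%E &
      (\int[haar R m.+1]_u g u = \int[leb]_x \int[leb]_y H x y)%E].
Proof.
move=> mg g0.
pose J v := (\int[leb]_t g (v, t))%E.
have mJ : measurable_fun setT J.
  exact: (measurable_fun_fubini_tonelli_F (m2 := leb) g mg g0).
have J0 v : (0 <= J v)%E by apply: integral_ge0.
pose Jc (q : (measurableTypeR R * measurableTypeR R) *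
   m.-tuple (measurableTypeR R * measurableTypeR R)) := J (tcons q).
have mJc : measurable_fun setT Jc.
  by apply: measurableT_comp => //; exact: measurable_tcons.
have Jc0 q : (0 <= Jc q)%E by exact: J0.
pose H2 q := (\int[tuple_measure leb2 m]_v Jc (q, v))%E.
have mH : measurable_fun setT H2.
  exact: (measurable_fun_fubini_tonelli_F (m2 := tuple_measure leb2 m) Jc mJc Jc0).
exists (fun x y => H2 (x, y)); split.
- by move=> x y; apply: integral_ge0.
- have -> : (fun q => H2 (q.1, q.2)) = H2 by apply/funext => -[].
  exact: mH.
- by move=> x y.
rewrite haar_integral1//.
transitivity (\int[prod_measure leb2 (tuple_measure leb2 m)]_q Jc q)%E.
  rewrite [LHS]/= (_ : (fun v => \int[lebesgue_measure]_t g (v, t))%E = J)//.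
  exact: (@ge0_integral_pushforward _ _ _ _ R (@tcons _ _ _) (@measurable_tcons _ _ _)
    (prod_measure leb2 (tuple_measure leb2 m)) setT J measurableT mJ
    (fun y _ => J0 y)).
transitivity (\int[leb2]_q H2 q)%E.
  exact: (fubini_tonelli1 (m1 := leb2) (m2 := tuple_measure leb2 m) Jc mJc Jc0).
have H20 q : (0 <= H2 q)%E by apply: integral_ge0.
exact: (fubini_tonelli1 (m1 := leb) (m2 := leb) H2 mH H20).
Qed.

End haar.

Section haar_translation.
Variables (R : realType) (m : nat).
Local Notation leb := (@lebesgue_measure R).

Lemma measurable_partial2 d1 d2 d3 (T1 : measurableType d1)
    (T2 : measurableType d2) (T3 : measurableType d3) (f : T1 * T2 -> T3) x :
  measurable_fun setT f -> measurable_fun setT (fun y => f (x, y)).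
Proof.
move=> mf; apply: (measurableT_comp mf (g := fun y => (x, y))).
by apply: measurable_fun_pair => //; exact: measurable_cst.
Qed.

(** The shift of t is constant once x and y are fixed, so it is removed first, in the inner
    integral; the shifts of y and x follow. *)
Lemma haar_integral_translate (g g' : heis_coord R m.+1 -> \bar R)
    (a b : R) (k : R -> R -> R) :
  measurable_fun setT g -> measurable_fun setT g' ->
  (forall u, 0 <= g u)%E -> (forall u, 0 <= g' u)%E ->
  (forall x y v t, g' (coord_cons x y v t) =
    g (coord_cons (x + a) (y + b) v (t + k x y))) ->
  (\int[haar R m.+1]_u g' u = \int[haar R m.+1]_u g u)%E.
Proof.
move=> mg mg' g0 g'0 gg'.
have [H [H0 mH HE ->]] := haar_integralS mg g0.
have [H' [_ _ H'E ->]] := haar_integralS mg' g'0.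
have HH' x y : H' x y = H (x + a) (y + b).
  rewrite HE H'E; apply: eq_integral => v _.
  under eq_integral do rewrite gg'.
  apply: (@ge0_integral_shift R (k x y)
    (fun t => g (coord_cons (x + a) (y + b) v t))) => [|t]; last exact: g0.
  exact: (measurable_partial2 _ mg).
under eq_integral do under eq_integral do rewrite HH'.
transitivity (\int[leb]_x \int[leb]_y H (x + a)%R y)%E.
  apply: eq_integral => x _; apply: (@ge0_integral_shift R b (H (x + a))) => [|y].
    exact: (@measurable_partial2 _ _ _ _ _ _ (fun q => H q.1 q.2) _ mH).
  exact: H0.
apply: (@ge0_integral_shift R a (fun x => \int[leb]_y H x y)%E) => [|x].
  apply: (@measurable_fun_fubini_tonelli_F _ _ _ _ R leb (fun q => H q.1 q.2) mH).
  by move=> q; exact: H0.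
exact: integral_ge0.
Qed.

End haar_translation.

Section heis_shift.
Variables (R : realType) (m : nat).

(* Left translation by [c e_0, 0]. *)
Definition heis_shift (c : R[i]) (q : heis R m.+1) : heis R m.+1 :=
  (\row_j (q.1 ord0 j + c *+ (j == ord0)),
   q.2 + (complex.Re c * complex.Im (q.1 ord0 ord0) -
          complex.Im c * complex.Re (q.1 ord0 ord0)) / 2).

Lemma heis_shift_coord a b x y v t :
  heis_shift (a +i* b) (heis_of_coord (coord_cons x y v t)) =
  heis_of_coord (coord_cons (x + a) (y + b) v (t + (a * y - b * x) / 2)).
Proof.
rewrite /heis_shift /heis_of_coord /= !mxE /=; congr pair.
apply/rowP => j; rewrite !mxE /=.
case: (unliftP ord0 j) => [j' ->|->].
  by rewrite -(inj_eq val_inj) /= mulr0n addr0 !(tnth_nth (0, 0)).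
by rewrite eqxx mulr1n.
Qed.

Lemma sqnorm_shift c (z : 'rV[R[i]]_m.+1) t :
  sqnorm (heis_shift c (z, t)).1 = sqnorm z +
    2 * (complex.Re c * complex.Re (z ord0 ord0) +
         complex.Im c * complex.Im (z ord0 ord0)) + Normc.normc c ^+ 2.
Proof.
have sq (w : R[i]) : Normc.normc w ^+ 2 = complex.Re w ^+ 2 + complex.Im w ^+ 2.
  by case: w => u v /=; rewrite sqr_sqrtr// addr_ge0// sqr_ge0.
rewrite /sqnorm !big_ord_recl !mxE eqxx mulr1n.
rewrite (eq_bigr (fun j => Normc.normc (z ord0 (lift ord0 j)) ^+ 2)); last first.
  by move=> j _; rewrite !mxE addr0.
by rewrite !sq; case: c => c1 c2; case: (z ord0 ord0) => z1 z2 /=; ring.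
Qed.

Lemma continuous_heis_shift (r : R) :
  continuous (fun x : R * (Crow R m.+1 * R) =>
    heis_shift (circ r x.1) x.2 : Crow R m.+1 * R).
Proof.
have cc : continuous (fun x : R * (Crow R m.+1 * R) => circ r x.1).
  exact: (continuous_after (@continuous_circ R r) (@continuous_proj1 _ _)).
have cz j : continuous (fun x : R * (Crow R m.+1 * R) => x.2.1 ord0 j : R[i]^o).
  apply: (continuous_after (@continuous_coord R m.+1 j)).
  exact: (continuous_after (@continuous_proj1 _ _) (@continuous_proj2 _ _)).
apply: continuous_pair.
  move=> x; apply: cvg_row => j; rewrite mxE; under eq_cvg do rewrite mxE.
  apply: cvgD; first exact: (cz j x).
  by case: eqP => _; [exact: (cc x)|exact: cvg_cst].
apply: continuous_add.
  exact: (continuous_after (@continuous_proj2 _ _) (@continuous_proj2 _ _)).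
move=> x; apply: cvgMl; apply: cvgB; apply: cvgM.
- exact: cvg_Re (cc x).
- exact: cvg_Im (cz ord0 x).
- exact: cvg_Im (cc x).
- exact: cvg_Re (cz ord0 x).
Qed.

Variables (F : Cn1 R m.+1 -> R[i]^o) (p : R).
Hypotheses (dF : forall zeta, differentiable F zeta) (p1 : 1 < p).

(* The translates are the points of the circle of radius r in the complex line
   through the given point in the direction (e_0, (i/2) conj z_0), and on this
   circle the height is h - r^2 / 4. *)
Lemma submean_slice (h r : R) q : 0 < r ->
  pi *+ 2 * Normc.normc (slice F h q) `^ p <=
  itv_int 0 (pi *+ 2) (fun t =>
    Normc.normc (slice F (h - r ^+ 2 / 4) (heis_shift (circ r t) q)) `^ p).
Proof.
case: q => z t r0.
pose e : Crow R m.+1 := \row_j (j == ord0)%:R.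
pose f (w : R[i]^o) : R[i]^o := F ((z : Crow R m.+1) + w *: e,
  (t +i* (4^-1 * sqnorm z + h)) + (0 +i* 2^-1) * (z ord0 ord0)^*%C * w).
have df w : differentiable f w.
  apply: (@differentiable_comp _ _ _ _ (fun w : R[i]^o => ((z : Crow R m.+1) + w *: e,
    (t +i* (4^-1 * sqnorm z + h)) + (0 +i* 2^-1) * (z ord0 ord0)^*%C * w)
    : Cn1 R m.+1) F); last exact: dF.
  apply: differentiable_pair.
    by apply: (@differentiableD _ _ _ (cst (z : Crow R m.+1))
      (fun w : R[i]^o => w *: e)) => //.
  by apply: (@differentiableD _ _ _ (cst (t +i* (4^-1 * sqnorm z + h) : R[i]^o))
    (fun w : R[i]^o => (0 +i* 2^-1) * (z ord0 ord0)^*%C * w : R[i]^o)) => //.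
have := submean_powR 0 p1 df r0.
have -> : f 0 = slice F h (z, t).
  by rewrite /f scale0r mulr0 !addr0.
move=> /le_trans; apply; rewrite le_eqVlt; apply/orP; left; apply/eqP.
apply: eq_Rintegral => s _; congr (Normc.normc (F _) `^ p).
rewrite add0r; congr pair.
  by apply/rowP => j; rewrite !mxE mulr_natr.
rewrite [in RHS]sqnorm_shift normc_circ ?(ltW r0)//.
rewrite /heis_shift /=; case: (z ord0 ord0) => z1 z2.
apply/eqP; rewrite eq_complex /=.
by apply/andP; split; apply/eqP; field.
Qed.

Let I h := (\int[haar R m.+1]_u
  (Normc.normc (slice F h (heis_of_coord u)) `^ p)%:E)%E.

Let p0 : 0 < p. Proof. exact: lt_trans p1. Qed.

Let cF : continuous F.
Proof. by move=> z; exact/differentiable_continuous/dF. Qed.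

Let cS h : continuous (fun q : Crow R m.+1 * R => Normc.normc (slice F h q) `^ p).
Proof. by apply: continuous_normc_powR => //; exact: continuous_slice. Qed.

(** [submean_slice] is integrated over the group. Tonelli makes the angle the outer variable, and
    for each angle translation invariance gives the same inner integral, so the factor 2 pi
    cancels. *)
Lemma integral_slice_le (h r : R) : 0 < r -> (I h <= I (h - r ^+ 2 / 4))%E.
Proof.
move=> r0; set h' := h - _.
have pi2_gt0 : 0 < pi *+ 2 :> R by rewrite mulrn_wgt0// pi_gt0.
pose K (x : measurableTypeR R * heis_coord R m.+1) : R :=
  Normc.normc (slice F h' (heis_shift (circ r x.1) (heis_of_coord x.2))) `^ p.
have cK : continuous (fun x : R * (Crow R m.+1 * R) =>
    Normc.normc (slice F h' (heis_shift (circ r x.1) x.2)) `^ p).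
  exact: (continuous_after (@cS h') (@continuous_heis_shift r)).
have mK : measurable_fun setT K by exact: (measurable_heis_param cK).
have K0 x : (0 <= (K x)%:E)%E by rewrite lee_fin powR_ge0.
have mS h1 : measurable_fun setT (fun u : heis_coord R m.+1 =>
    (Normc.normc (slice F h1 (heis_of_coord u)) `^ p)%:E).
  by apply/measurable_EFinP; exact: (measurable_heis (@cS h1)).
have S0 h1 u : (0 <= (Normc.normc (slice F h1 (heis_of_coord u)) `^ p)%:E)%E.
  by rewrite lee_fin powR_ge0.
have IK t : (\int[haar R m.+1]_u (K (t, u))%:E = I h')%E.
  apply: (@haar_integral_translate _ _ _ _ (r * cos t) (r * sin t)
    (fun x y => (r * cos t * y - r * sin t * x) / 2)) => // [|x y v s].
    apply/measurable_EFinP; exact: (measurable_partial2 _ mK).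
  by rewrite /K /= -heis_shift_coord.
pose k : measurableTypeR R * heis_coord R m.+1 -> \bar R :=
  (EFin \o K) \_ (`[0, pi *+ 2] `*` setT).
have mk : measurable_fun setT k.
  have mD : measurable (`[0, pi *+ 2]%classic `*` setT :
      set (measurableTypeR R * heis_coord R m.+1)).
    by apply: measurableX => //; exact: measurable_itv.
  apply/(measurable_restrictT _ mD); apply: measurable_funTS.
  exact/measurable_EFinP.
have k0 x : (0 <= k x)%E.
  by rewrite /k patchE; case: ifPn => // _; exact: K0.
have kE t u : k (t, u) = ((fun t => (K (t, u))%:E) \_ `[0, pi *+ 2]) t.
  rewrite /k !patchE; congr (if _ then _ else _).
  by apply/idP/idP; rewrite !inE /=; [case|split].
have := fubini_tonelli (m1 := @lebesgue_measure R) (m2 := haar R m.+1) k mk k0.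
have -> : (\int[@lebesgue_measure R]_t \int[haar R m.+1]_u k (t, u) =
    (pi *+ 2)%:E * I h')%E.
  rewrite (_ : (fun t => \int[haar R m.+1]_u k (t, u))%E =
      (cst (I h')) \_ `[0, pi *+ 2]).
    rewrite -integral_mkcond integral_cst//= muleC; congr (_ * _)%E.
    have -> // : lebesgue_measure `[0, pi *+ 2]%classic = (pi *+ 2 : R)%:E.
    by rewrite lebesgue_measure_itv/= lte_fin pi2_gt0 -EFinB subr0.
  apply/funext => t; rewrite patchE; case: ifPn => ht.
    by rewrite /cst -(IK t); apply: eq_integral => u _; rewrite kE patchE ht.
  by apply: integral0_eq => u _; rewrite kE patchE (negPf ht).
move=> E.
have c0 : (0 < (pi *+ 2 : R)%:E)%E by rewrite lte_fin.
rewrite -(lee_pmul2l (isT : (pi *+ 2 : R)%:E \is a fin_num) c0 (I h) (I h')) {}E.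
rewrite -(ge0_integralZl _ measurableT (mS h) (fun u _ => S0 h u) (ltW c0)).
apply: ge0_le_integral => //.
- by move=> u _; rewrite mule_ge0// lee_fin ltW.
- by apply: measurable_funeM.
- exact: (measurable_fun_fubini_tonelli_G (m1 := @lebesgue_measure R) k mk k0).
move=> u _; under eq_integral do rewrite kE.
rewrite -integral_mkcond -EFinM.
have cKu : continuous (fun t => K (t, u)).
  exact: (@continuous_partial1 _ _ _ _ (heis_of_coord u : Crow R m.+1 * R) cK).
by rewrite -itv_intE// lee_fin; exact: submean_slice.
Qed.

End heis_shift.

(** * The inequality on the Heisenberg group *)

Lemma sqnorm_ge0 (R : realType) (n : nat) (z : 'rV[R[i]]_n) : 0 <= sqnorm z.
Proof. by apply: sumr_ge0 => j _; rewrite sqr_ge0. Qed.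

(** The squared gauge is the square root of (|z|^2/4)^2 + t^2. For fixed z the growth is thus of
    exponential type in t and h. *)
Lemma heis_gauge_sqr_le (R : realType) (n : nat) (z : 'rV[R[i]]_n) (t : R) :
  heis_gauge (z, t) ^+ 2 <= 4^-1 * sqnorm z + `|t|.
Proof.
have q0 := sqnorm_ge0 z.
rewrite /heis_gauge /=; set Y := 4^-1 * sqnorm z + `|t|.
have Y0 : 0 <= Y by rewrite addr_ge0// mulr_ge0.
have XY : 16^-1 * sqnorm z ^+ 2 + t ^+ 2 <= Y ^+ 2.
  rewrite /Y -[t ^+ 2]real_normK ?num_real//.
  have := mulr_ge0 q0 (normr_ge0 t); move: (sqnorm z) `|t| => q s; lra.
have YE : ((Y ^+ 2) `^ 4^-1) ^+ 2 = Y.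
  rewrite -(powR_mulrn 2 (powR_ge0 _ _)) -(powR_mulrn 2 Y0) -!powRrM.
  by rewrite [X in Y `^ X](_ : _ = 1) ?powRr1//; field.
rewrite -[leRHS]YE ler_sqr ?nnegrE ?powR_ge0//.
apply: ge0_ler_powR; rewrite ?nnegrE ?sqr_ge0//.
by rewrite addr_ge0 ?sqr_ge0// mulr_ge0// sqr_ge0.
Qed.

Section slices.
Variables (R : realType) (n : nat) (a p : R) (F : Cn1 R n -> R[i]^o).
Hypotheses (a0 : 0 < a) (p1 : 1 < p) (FE : expo_type a F).

Let dF zeta : differentiable F zeta. Proof. by apply: (FE.1). Qed.

Let p0 : 0 < p. Proof. exact: lt_trans p1. Qed.

Let cF : continuous F.
Proof. by move=> z; exact/differentiable_continuous/dF. Qed.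

Lemma measurable_slice_powR h : measurable_fun setT (fun u : heis_coord R n =>
  (Normc.normc (slice F h (heis_of_coord u)) `^ p)%:E).
Proof.
apply/measurable_EFinP; apply: (@measurable_heis R n
  (fun q : Crow R n * R => Normc.normc (slice F h q) `^ p)).
by apply: continuous_normc_powR => //; exact: continuous_slice.
Qed.

(** With t as the inner variable, the inequality on a line is applied for each z; its constant is
    the same for all z. *)
Lemma integral_slice_lower y : 0 < y ->
  (heis_integral (fun q => Normc.normc (slice F (- y) q) `^ p)%R <=
   (expR (a * p * y))%:E *
     heis_integral (fun q => Normc.normc (slice F 0 q) `^ p)%R)%E.
Proof.
move=> y0; rewrite /heis_integral.
have S0 h u : (0 <= (Normc.normc (slice F h (heis_of_coord u)) `^ p)%:E)%E.
  by rewrite lee_fin powR_ge0.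
have mS := measurable_slice_powR.
rewrite !haar_integral1//.
have J0 v : (0 <= \int[@lebesgue_measure R]_t
    (Normc.normc (slice F 0 (heis_of_coord (v, t))) `^ p)%:E)%E.
  by apply: integral_ge0.
have mJ h := measurable_fun_fubini_tonelli_F (m2 := @lebesgue_measure R) _
  (mS h) (S0 h).
rewrite -ge0_integralZl//; last exact: mJ.
apply: ge0_le_integral => //.
- by move=> v _; apply: integral_ge0.
- exact: mJ.
- by apply: measurable_funeM; exact: mJ.
move=> v _; pose z : Crow R n := \row_j ((tnth v j).1 +i* (tnth v j).2).
pose G (w : R[i]^o) : R[i]^o := F (z, w + (0 +i* (4^-1 * sqnorm z))).
have GE h t : slice F h (heis_of_coord (v, t)) = G (t +i* h).
  rewrite /slice /heis_of_coord /G /=; congr (F (_, _)).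
  by apply/eqP; rewrite eq_complex /= addr0 eqxx addrC eqxx.
have dG w : differentiable G w.
  apply: (@differentiable_comp _ _ _ _
    (fun w : R[i]^o => (z, w + (0 +i* (4^-1 * sqnorm z))) : Cn1 R n) F); last exact: dF.
  apply: differentiable_pair; first exact: differentiable_cst.
  by apply: (@differentiableD _ _ _ id (cst (0 +i* (4^-1 * sqnorm z) : R[i]^o))).
have G_le eps : 0 < eps -> exists2 C, 0 < C & forall t h,
    Normc.normc (G (t +i* h)) <= C * expR ((a + eps) * (`|t| + `|h|)).
  move=> eps0; have [C C0 FC] := FE.2 _ eps0.
  (* The contribution of z to the gauge is absorbed into the constant. *)
  exists (C * expR ((a + eps) * (4^-1 * sqnorm z))).
    by rewrite mulr_gt0// expR_gt0.
  move=> t h; rewrite (le_trans (FC _))// -mulrA ler_pM2l// -expRD ler_expR.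
  rewrite -mulrDr ler_pM2l ?addr_gt0// /gaugeU /Psi /= addrK addr0 addrA lerD2r.
  exact: heis_gauge_sqr_le.
have := plancherel_polya_line a0 p1 dG G_le y0.
under eq_integral do rewrite -GE.
by under [X in (_ <= _ * X)%E -> _]eq_integral do rewrite -GE.
Qed.

Lemma heis_Lnorm_powR h : (heis_Lnorm p (slice F h) `^ p =
  heis_integral (fun q => Normc.normc (slice F h q) `^ p)%R)%E.
Proof.
have pn0 : p != 0 by rewrite gt_eqF.
rewrite /heis_Lnorm (powR_Lnorm _ _ pn0); apply: eq_integral => u _.
by rewrite gee0_abs ?lee_fin ?normc_ge0// poweR_EFin.
Qed.

End slices.

Theorem proposition3p3 (R : realType) (n : nat) (a p : R)
    (F : Cn1 R n -> R[i]^o) :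
  (1 <= n)%N -> 0 < a -> 1 < p ->
  expo_type a F -> heis_Lp p (slice F 0) ->
  (forall h : R,
     (heis_integral (fun q => Normc.normc (slice F h q) `^ p)%R
        <= (expR (a * p * (- Num.min 0 h)))%:E * heis_Lnorm p (slice F 0) `^ p)%E)
  /\ (forall c : R, hardy p c F).
Proof.
(* n >= 1 supplies the coordinate e_0 along which the translations are taken for h > 0. *)
case: n F => // m F _ a0 p1 FE [_ _ F0].
have p0 : 0 < p := lt_trans ltr01 p1.
have ineq h : (heis_integral (fun q => Normc.normc (slice F h q) `^ p)%R
    <= (expR (a * p * (- Num.min 0 h)))%:E * heis_Lnorm p (slice F 0) `^ p)%E.
  rewrite heis_Lnorm_powR//; have [h0|h0|->] := ltgtP h 0; last first.
  - by rewrite oppr0 mulr0 expR0 mul1e.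
  - rewrite oppr0 mulr0 expR0 mul1e.
    have r0 : 0 < 2 * Num.sqrt h by rewrite mulr_gt0// sqrtr_gt0.
    have dF zeta : differentiable F zeta by apply: (FE.1).
    have rE : h - (2 * Num.sqrt h) ^+ 2 / 4 = 0.
      by rewrite exprMn sqr_sqrtr ?(ltW h0)//; field.
    by have := integral_slice_le dF p1 h r0; rewrite rE.
  - have := @integral_slice_lower _ _ _ _ _ a0 p1 FE (- h).
    by rewrite oppr_gt0 opprK => /(_ h0).
split=> // c; split; first by move=> zeta _; apply: (FE.1).
(* Since h_- does not increase with h, the bound at height c is valid at every height h > c. *)
pose K := ((expR (a * p * (- Num.min 0 c)))%:E * heis_Lnorm p (slice F 0) `^ p)%E.
have Kfin : (K < +oo)%E.
  by rewrite /K lte_mul_pinfty ?lee_fin ?expR_ge0 ?fin_numE// poweR_lty.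
apply: (@le_lt_trans _ _ (K `^ p^-1)%E); last exact: poweR_lty.
apply: ge_ereal_sup => _ [h /= ch <-].
have -> : (heis_Lnorm p (slice F h) = (heis_Lnorm p (slice F h) `^ p) `^ p^-1)%E.
  by rewrite -poweRrM mulfV ?gt_eqF// poweRe1// Lnorm_ge0.
apply: gt0_ler_poweR; rewrite ?invr_ge0 ?(ltW p0)//.
- by rewrite in_itv/= poweR_ge0 leey.
- by rewrite in_itv/= leey mule_ge0 ?poweR_ge0// lee_fin expR_ge0.
rewrite heis_Lnorm_powR// (le_trans (ineq h))// /K lee_wpmul2r ?poweR_ge0//.
rewrite lee_fin ler_expR ler_pM2l ?mulr_gt0// lerN2.
by rewrite le_min ge_min lexx /= ge_min (ltW ch) orbT.
Qed.
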